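(* Let $\mu\ge0$ be a finite measure on $(-1,1)^\infty$, and let $$\alpha(p^\kappa)=\int_{(-1,1)^\infty}t^\kappa\,d\mu(t),\qquad \kappa\in\mathbb{N}_0^{(\infty)}.$$ Then the following are equivalent: (1) $M(\alpha)$ defines a bounded operator on $\ell^2(\mathbb{N})$. (2) $\mu$ is a Carleson measure for $H^2(\mathbb{T}^\infty)$. (3) The operators $G_d:L^2(\mu)\to L^2(\mu)$, $d\in\mathbb{N}$, are bounded and converge, as $d\to\infty$, in the strong operator topology to a limit $G_\infty:L^2(\mu)\to L^2(\mu)$, i.e. $G_\infty f=\lim_{d\to\infty}G_df$ for all $f\in L^2(\mu)$.
   Context: $\mathbb{N}=\{1,2,\dots\}$, $\mathbb{N}_0=\{0,1,\dots\}$; $\mathbb{N}_0^{(\infty)}$ is the set of finitely supported multi-indices $\kappa=(\kappa_1,\kappa_2,\dots)$ with $\kappa_j\in\mathbb{N}_0$; $t^\kappa=\prod_j t_j^{\kappa_j}$. With $p_1<p_2<\dots$ the primes, $p^\kappa=\prod_j p_j^{\kappa_j}$, which is a bijection between $\mathbb{N}_0^{(\infty)}$ and $\mathbb{N}$; so $\alpha$ is a sequence $\{\alpha(n)\}_{n=1}^\infty$. Measures on $(-1,1)^\infty$ are Borel measures for the product topology. $M(\alpha)=\{\alpha(nm)\}_{n,m=1}^\infty$ is the Helson matrix of $\alpha$, viewed as a (potentially unbounded) operator on $\ell^2(\mathbb{N})$; it defines a bounded operator if there is $C$ with $|\sum_{n,m}\alpha(nm)f_n\overline{g_m}|\le C\|f\|_{\ell^2}\|g\|_{\ell^2}$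 for all finitely supported sequences $f,g$. $H^2(\mathbb{T}^\infty)$ is the Hilbert space of power series $f(z)=\sum_{\kappa\in\mathbb{N}_0^{(\infty)}}f_\kappa z^\kappa$ with $\|f\|^2_{H^2(\mathbb{T}^\infty)}=\sum_\kappa|f_\kappa|^2<\infty$. A finite measure $\mu$ on $\mathbb{D}^\infty$ (in particular on $(-1,1)^\infty$) is a Carleson measure for $H^2(\mathbb{T}^\infty)$ if there is $C>0$ such that $\int|f(z)|^2\,d|\mu|(z)\le C\|f\|^2_{H^2(\mathbb{T}^\infty)}$ for all polynomials $f$ (finite linear combinations of monomials $z^\kappa$). For $d\in\mathbb{N}$ and $s,t\in(-1,1)^\infty$, $K_d(s,t)=\prod_{j=1}^d\frac{1}{1-s_jt_j}$ (depending only on the first $d$ coordinates), and $$G_df(t)=\int_{(-1,1)^\infty}K_d(s,t)f(s)\,d\mu(s),\qquad f\in L^2(\mu),\ t\in(-1,1)^\infty.$$ *)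

(* Defs.v *)
From HB Require Import structures.
From mathcomp Require Import all_boot all_order all_algebra.
From mathcomp Require Import finmap complex.
From mathcomp Require Import all_classical all_reals all_analysis.

Set Implicit Arguments.
Unset Strict Implicit.
Unset Printing Implicit Defensive.

Import Order.TTheory GRing.Theory Num.Theory.
Import numFieldNormedType.Exports.
Import ComplexField.Normc.

Local Open Scope classical_set_scope.
Local Open Scope ring_scope.
Local Open Scope complex_scope.

(* All coordinates, and hence the primes, are numbered from 0: index j stands
   for j + 1 in the usual notation, so that nth_prime 0 = 2. *)

Lemma ex_prime_gt (m : nat) : exists p, (m < p)%N && prime p.
Proof. by have [p mp pp] := prime_above m; exists p; rewrite mp pp. Qed.

Definition next_prime (m : nat) : nat := ex_minn (ex_prime_gt m).

Definition nth_prime (j : nat) : nat := iter j next_prime 2.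

Notation multiindex := {fsfun nat -> nat with 0%N}.

Definition prime_monomial (kappa : multiindex) : nat :=
  (\prod_(j <- finsupp kappa) nth_prime j ^ kappa j)%N.

Notation open_unit R := (set_type (`]-1, 1[%classic : set R)).

Lemma open_unit0_subproof (R : realType) :
  (0 : R) \in (`]-1, 1[%classic : set R).
Proof. by rewrite inE /= in_itv /= ltrN10 ltr01. Qed.

Definition open_unit0 (R : realType) : open_unit R :=
  exist _ 0 (open_unit0_subproof R).

(* (-1,1)^oo with the product topology ... *)
Definition cube (R : realType) : Type :=
  prod_topology (fun _ : nat => open_unit R).

HB.instance Definition _ (R : realType) :=
  Topological.copy (cube R) (prod_topology (fun _ : nat => open_unit R)).

HB.instance Definition _ (R : realType) :=
  isPointed.Build (cube R) (fun=> open_unit0 R).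

(* ... and with the associated Borel sigma-algebra. *)
Notation borel_cube R := (g_sigma_algebraType (@open (cube R))).

Definition cube_coord (R : realType) (t : cube R) (j : nat) : R := set_val (t j).

Definition monomial (R : realType) (t : cube R) (kappa : multiindex) : R :=
  \prod_(j <- finsupp kappa) cube_coord t j ^+ kappa j.

(* The squared l^2 norm of a finitely supported family. *)
Definition fs_sqnorm (R : realType) (K : choiceType)
    (f : {fsfun K -> R[i] with 0}) : R :=
  \sum_(k <- finsupp f) normc (f k) ^+ 2.

Notation posnat := {n : nat | (0 < n)%N}.

(* The sequence alpha is indexed by n >= 1; the value alpha 0 is never used. *)
Definition helson_form (R : realType) (alpha : nat -> R[i])
    (f g : {fsfun posnat -> R[i] with 0}) : R[i] :=
  \sum_(n <- finsupp f) \sum_(m <- finsupp g)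
    alpha (val n * val m)%N * f n * (g m)^*.

Definition helson_bounded (R : realType) (alpha : nat -> R[i]) : Prop :=
  exists C : R, forall f g : {fsfun posnat -> R[i] with 0},
    normc (helson_form alpha f g)
      <= C * Num.sqrt (fs_sqnorm f) * Num.sqrt (fs_sqnorm g).

(* A polynomial in z_1, z_2, ... is given by its coefficients. *)
Notation polynomial R := {fsfun multiindex -> R[i] with 0}.

Definition poly_eval (R : realType) (f : polynomial R) (t : cube R) : R[i] :=
  \sum_(kappa <- finsupp f) f kappa * (monomial t kappa)%:C.

(* By orthonormality of the monomials, fs_sqnorm is the squared norm of a
   polynomial in H^2(T^oo). *)
Definition carleson (R : realType)
    (mu : {finite_measure set (borel_cube R) -> \bar R}) : Prop :=
  exists2 C : R, 0 < C & forall f : polynomial R,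
    (\int[mu]_t ((normc (poly_eval f t) ^+ 2)%:E) <= (C * fs_sqnorm f)%:E)%E.

Section L2.
Context {d : measure_display} {T : measurableType d} {R : realType}.
Variable mu : {measure set T -> \bar R}.

Definition cintegral (f : T -> R[i]) : R[i] :=
  Complex (\int[mu]_x complex.Re (f x)) (\int[mu]_x complex.Im (f x)).

Definition L2norm (f : T -> R[i]) : \bar R :=
  Lnorm mu 2%:E (fun x => (normc (f x))%:E).

Definition L2 (f : T -> R[i]) : Prop :=
  [/\ measurable_fun setT (fun x => complex.Re (f x)),
      measurable_fun setT (fun x => complex.Im (f x)) &
      (L2norm f < +oo)%E].

(* Bounded linear operators on the Hilbert space L^2(mu) of classes modulo
   equality almost everywhere, in terms of representatives. Invariance under
   almost everywhere equality follows from linearity and boundedness. The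
   values of A outside L2 are irrelevant. *)
Definition L2_bounded_operator (A : (T -> R[i]) -> T -> R[i]) : Prop :=
  [/\ (forall f, L2 f -> L2 (A f)),
      (forall (a : R[i]) f g, L2 f -> L2 g ->
        {ae mu, forall x, A (fun y => a * f y + g y) x = a * A f x + A g x}) &
      exists C : R, forall f, L2 f -> (L2norm (A f) <= C%:E * L2norm f)%E].

Definition L2_strong_cvg (A : nat -> (T -> R[i]) -> T -> R[i])
    (B : (T -> R[i]) -> T -> R[i]) : Prop :=
  forall f, L2 f ->
    (fun n => L2norm (fun x => A n f x - B f x)) @ \oo --> 0%E.

End L2.

Definition szego_kernel (R : realType) (d : nat) (s t : cube R) : R :=
  \prod_(j < d) (1 - cube_coord s j * cube_coord t j)^-1.

Definition Gop (R : realType)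
    (mu : {finite_measure set (borel_cube R) -> \bar R}) (d : nat)
    (f : borel_cube R -> R[i]) (t : borel_cube R) : R[i] :=
  cintegral mu (fun s => (szego_kernel d s t)%:C * f s).

(* Main.v *)
Require Import Defs.
From HB Require Import structures.
From mathcomp Require Import all_boot all_order all_algebra.
From mathcomp Require Import finmap complex.
From mathcomp Require Import all_classical all_reals all_analysis.
From mathcomp Require Import measurable_realfun.
From mathcomp Require Import ring lra.

(** Let A be the map that sends a finite family c of coefficients to the function
t |-> sum_kappa c_kappa t^kappa. That mu is a Carleson measure means that A is
bounded from l^2 to L^2(mu). Its adjoint sends u to the family of its moments
int t^kappa u dmu. Hence A^*A is the matrix of inner products of the monomials,
which becomes the Helson matrix M(alpha) once kappa is identified with p^kappa,
and G_d = A P_d A^*, where P_d keeps the coefficients whose multi-index is carried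
by the first d coordinates. As P_d increases to the identity, G_d should converge
to A A^*, and the three conditions say that A, A^*A and A A^* are bounded. All
coordinates t_j are real, so real and imaginary parts can be treated separately;
the analysis is done for real functions, with [sqn] for the squared norm.

(1) <-> (2): by [helson_formE] the Helson form consists of inner products of
polynomials, and on the diagonal it is the squared norm of a polynomial; the rest is
Cauchy-Schwarz.

(2) -> (3): by duality the moments of u satisfy the Bessel inequality
[moment_bessel]. In order to work with finite sums only, K_d is approximated by
products of partial geometric sums, whose operators [Gtrunc] are A P A^* with P the
projection onto a finite box of multi-indices. They are bounded uniformly, and
they converge pointwise to G_d ([Gtrunc_cvg]), so Fatou's lemma bounds G_d
([Greal_bounded]). The same argument applied to differences bounds
|G_m u - G_n u|^2 by a tail of the sum of the squared moments ([Greal_cauchy]). The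
limit then exists because L^2 is complete ([sq_integrable_complete]). It cannot be
written with the infinite product kernel: for some Carleson measures
prod_j 1 / (1 - t_j^2) diverges for almost every t.

(3) -> (2): the kernels are positive definite, so for a polynomial p the sum of the
squared moments of p over the support of p is at most <G_d p, p> for d large
([moment_sq_le_Greal]), and in the limit at most a constant times |p|^2. Since
|p|^2 is the inner product of the coefficients of p with its moments, this bounds
|p|^2 by a multiple of the squared norm of the coefficients ([carleson_of_Glim]). *)

Set Implicit Arguments.
Unset Strict Implicit.
Unset Printing Implicit Defensive.

Import Order.TTheory GRing.Theory Num.Theory.
Import numFieldNormedType.Exports.
Import ComplexField.Normc.

Local Open Scope classical_set_scope.
Local Open Scope ring_scope.
Local Open Scope complex_scope.

(** * Real square-integrable functions *)

Section SquareIntegrable.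
Context d (T : measurableType d) (R : realType).
Variable mu : {finite_measure set T -> \bar R}.
Implicit Types u v : T -> R.

Definition sq_integrable u : Prop :=
  measurable_fun setT u /\ mu.-integrable setT (fun x => (u x ^+ 2)%:E).

(** The squared norm is kept as the basic quantity: the crude inequality
[sqnD_le] then replaces the triangle inequality, since the values of the
constants are immaterial. *)
Definition sqn u : R := \int[mu]_x (u x ^+ 2).

Lemma sqn_ge0 u : 0 <= sqn u.
Proof. by apply: Rintegral_ge0 => x _; exact: sqr_ge0. Qed.

(** Dominate [u v] by [u^2 + v^2]. *)
Lemma integrableM_sq u v : sq_integrable u -> sq_integrable v ->
  mu.-integrable setT (fun x => (u x * v x)%:E).
Proof.
move=> [mu1 iu] [mv iv].
apply: (@le_integrable _ _ _ mu _ _ _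
  (fun x => ((u x ^+ 2)%:E + (v x ^+ 2)%:E)%E)) => //.
- by apply/measurable_EFinP; apply: measurable_funM.
- move=> x _; rewrite -EFinD !abse_EFin lee_fin.
  rewrite [leRHS]ger0_norm ?addr_ge0 ?sqr_ge0// ler_norml.
  by apply/andP; split; nra.
- exact: integrableD.
Qed.

Lemma sq_integrableD u v : sq_integrable u -> sq_integrable v ->
  sq_integrable (fun x => u x + v x).
Proof.
move=> su sv; have iuv := integrableM_sq su sv.
case: su sv => [mu1 iu] [mv iv]; split; first exact: measurable_funD.
rewrite (_ : (fun x => _) =
    (fun x => (((u x ^+ 2)%:E + ((u x * v x)%:E + (u x * v x)%:E)) +
      (v x ^+ 2)%:E)%E)); last first.
  by apply/funext => x; rewrite -!EFinD; congr EFin; ring.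
by apply: integrableD => //; apply: integrableD => //; exact: integrableD.
Qed.

Lemma sq_integrableZ (a : R) u : sq_integrable u ->
  sq_integrable (fun x => a * u x).
Proof.
move=> [mu1 iu]; split; first exact: measurable_funM.
rewrite (_ : (fun x => _) = (fun x => ((a ^+ 2)%:E * (u x ^+ 2)%:E)%E)).
  exact: integrableZl.
by apply/funext => x; rewrite exprMn EFinM.
Qed.

Lemma sq_integrableB u v : sq_integrable u -> sq_integrable v ->
  sq_integrable (fun x => u x - v x).
Proof.
move=> su sv; have := sq_integrableD su (sq_integrableZ (-1) sv).
by congr sq_integrable; apply/funext => x; rewrite mulN1r.
Qed.

Lemma sq_integrable_bounded u (M : R) : measurable_fun setT u ->
  (forall x, `|u x| <= M) -> sq_integrable u.
Proof.
move=> mu1 uM; split=> //.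
apply: (@le_integrable _ _ _ mu _ _ _ (cst (M ^+ 2)%:E)) => //.
- by apply/measurable_EFinP; exact: measurable_funX.
- move=> x _ /=; rewrite lee_fin !normrX lerXn2r ?nnegrE//.
  by rewrite (le_trans (uM x))// ler_norm.
- exact: finite_measure_integrable_cst.
Qed.

Lemma sq_integrable_sum (I : Type) (r : seq I) (c : I -> R) (u : I -> T -> R) :
  (forall i, sq_integrable (u i)) ->
  sq_integrable (fun x => \sum_(i <- r) c i * u i x).
Proof.
move=> su; elim: r => [|i r ih].
  apply: (@sq_integrable_bounded _ 0).
    by under eq_fun do rewrite big_nil; exact: measurable_cst.
  by move=> x; rewrite big_nil normr0.
under eq_fun do rewrite big_cons.
by apply: sq_integrableD => //; exact: sq_integrableZ.
Qed.

Lemma sqnDlin (a b : R) u v : sq_integrable u -> sq_integrable v ->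
  sqn (fun x => a * u x + b * v x) =
  a ^+ 2 * sqn u + 2 * a * b * (\int[mu]_x (u x * v x)) + b ^+ 2 * sqn v.
Proof.
move=> su sv; have iuv := integrableM_sq su sv.
case: su sv => [mu1 iu] [mv iv].
rewrite /sqn -!RintegralZl// -!RintegralD//; first last.
- by have := @integrableZl _ _ _ mu setT measurableT (2 * a * b) _ iuv.
- by have := @integrableZl _ _ _ mu setT measurableT (a ^+ 2) _ iu.
- by have := @integrableZl _ _ _ mu setT measurableT (b ^+ 2) _ iv.
- have i1 := @integrableZl _ _ _ mu setT measurableT (a ^+ 2) _ iu.
  have i2 := @integrableZl _ _ _ mu setT measurableT (2 * a * b) _ iuv.
  exact: (integrableD _ i1 i2).
by apply: eq_Rintegral => x _; ring.
Qed.

(** The quadratic form of [sqnDlin] is nonnegative at every pair of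
coefficients, hence has a nonpositive discriminant. *)
Lemma cauchy_schwarz_sq u v : sq_integrable u -> sq_integrable v ->
  (\int[mu]_x (u x * v x)) ^+ 2 <= sqn u * sqn v.
Proof.
move=> su sv.
have H a b : 0 <= a ^+ 2 * sqn u + 2 * a * b * (\int[mu]_x (u x * v x)) +
    b ^+ 2 * sqn v by rewrite -sqnDlin// sqn_ge0.
move: (sqn_ge0 u) (sqn_ge0 v) H.
move: (sqn u) (sqn v) (\int[mu]_x _) => U V W U0 V0 H.
have [V00|Vn0] := eqVneq V 0.
  (* With V = 0 these coefficients make the form equal to - W^2. *)
  have := H W (- (U + 1) / 2); rewrite V00 !mulr0 addr0.
  by rewrite (_ : _ + _ = - W ^+ 2) ?oppr_ge0//; field.
have Vp : 0 < V by rewrite lt0r Vn0.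
have := H V (- W); rewrite (_ : _ + _ = V * (U * V - W ^+ 2)); last by ring.
by rewrite pmulr_rge0// subr_ge0.
Qed.

(** The parallelogram identity, with the square of the difference discarded.
*)
Lemma sqnD_le u v : sq_integrable u -> sq_integrable v ->
  sqn (fun x => u x + v x) <= 2 * (sqn u + sqn v).
Proof.
move=> su sv; have /(_ 1 1) E1 := sqnDlin _ _ su sv.
have /(_ 1 (-1)) E2 := sqnDlin _ _ su sv.
have := sqn_ge0 (fun x => 1 * u x + -1 * v x).
rewrite E2; under [X in _ -> sqn X <= _]eq_fun do rewrite -[u _]mul1r -[v _]mul1r.
by rewrite E1; nra.
Qed.

Lemma sqnZ (a : R) u : sq_integrable u -> sqn (fun x => a * u x) = a ^+ 2 * sqn u.
Proof.
move=> [mu1 iu]; rewrite /sqn -RintegralZl//.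
by apply: eq_Rintegral => x _; rewrite exprMn.
Qed.

Lemma sqnBC u v : sqn (fun x => u x - v x) = sqn (fun x => v x - u x).
Proof. by apply: eq_Rintegral => x _; rewrite -sqrrN opprB. Qed.

Lemma EFin_sqn u : sq_integrable u -> (\int[mu]_x (u x ^+ 2)%:E)%E = (sqn u)%:E.
Proof.
by move=> [_ iu]; rewrite /sqn /Rintegral fineK//; exact: integrable_fin_num.
Qed.

Lemma sqn_eq0_ae u : sq_integrable u -> sqn u = 0 -> {ae mu, forall x, u x = 0}.
Proof.
move=> su u0; have [mu1 iu] := su.
have : (\int[mu]_x `|(u x ^+ 2)%:E| = 0)%E.
  under eq_integral do rewrite gee0_abs ?lee_fin ?sqr_ge0//.
  by rewrite EFin_sqn// u0.
have mu2 : measurable_fun setT (fun x => (u x ^+ 2)%:E).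
  by apply/measurable_EFinP; exact: measurable_funX.
move/(ae_eq_integral_abs mu measurableT mu2).
by apply: filterS => x /= /(_ I) [] /eqP; rewrite sqrf_eq0 => /eqP.
Qed.

(** Fatou's lemma is how bounds proved for truncated, finite-rank operators
pass to their pointwise limits. *)
Lemma fatou_sq (w : nat -> T -> R) v (B : R) :
  (forall n, sq_integrable (w n)) -> (forall n, sqn (w n) <= B) ->
  measurable_fun setT v -> {ae mu, forall x, w ^~ x @ \oo --> v x} ->
  sq_integrable v /\ sqn v <= B.
Proof.
move=> sw wB mv wv.
have mw n : measurable_fun setT (fun x => (w n x ^+ 2)%:E).
  by apply/measurable_EFinP; apply: measurable_funX; case: (sw n).
have mv2 : measurable_fun setT (fun x => (v x ^+ 2)%:E).
  by apply/measurable_EFinP; apply: measurable_funX.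
have F : (\int[mu]_x (v x ^+ 2)%:E <= B%:E)%E.
  rewrite (_ : (\int[mu]_x _)%E =
      (\int[mu]_x limn_einf (fun n => (w n x ^+ 2)%:E))%E).
    apply: le_trans (fatou mu measurableT mw _) _.
      by move=> n x _; rewrite lee_fin sqr_ge0.
    rewrite limn_einf_lim; apply: lime_le; first exact: is_cvg_einfs.
    apply: nearW => n; apply: le_trans (_ : \int[mu]_x (w n x ^+ 2)%:E <= _)%E.
      by apply: ereal_inf_lbound; exists n => /=.
    by rewrite EFin_sqn// lee_fin.
  apply: ge0_ae_eq_integral => //.
  - rewrite (_ : (fun x => _) =
        (fun x => - limn_esup (fun n => - (w n x ^+ 2)%:E))%E); last first.
      apply/funext => x; rewrite -limn_einfN; congr limn_einf.
      by apply/funext => n /=; rewrite opprK.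
    apply: measurableT_comp => //; apply: measurable_fun_limn_esup => n.
    exact: measurableT_comp.
  - by move=> x _; rewrite lee_fin sqr_ge0.
  - move=> x _; rewrite limn_einf_lim; apply: lime_ge; first exact: is_cvg_einfs.
    apply: nearW => n; apply: le_ereal_inf_tmp => _ [m _ <-].
    by rewrite lee_fin sqr_ge0.
  - apply: filterS wv => x wx _.
    have : (fun n => (w n x ^+ 2)%:E) @ \oo --> (v x ^+ 2)%:E.
      by apply: cvg_EFin; [exact: nearW|rewrite !expr2; exact: cvgM].
    by move=> /cvg_limn_einf_sup [-> _].
have sv : sq_integrable v.
  split=> //; apply/integrableP; split=> //.
  under eq_integral do rewrite gee0_abs ?lee_fin ?sqr_ge0//.
  by rewrite (le_lt_trans F)// ltry.
by split=> //; rewrite -lee_fin -EFin_sqn.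
Qed.

End SquareIntegrable.

Section DominatedRintegral.
Context d (T : measurableType d) (R : realType).
Variable mu : {measure set T -> \bar R}.

Lemma dominated_Rintegral_cvg (f_ : nat -> T -> R) (f g : T -> R) :
  (forall n, measurable_fun setT (f_ n)) ->
  (forall x, f_ ^~ x @ \oo --> f x) ->
  mu.-integrable setT (EFin \o g) ->
  (forall n x, `|f_ n x| <= g x) ->
  (\int[mu]_x f_ n x) @[n --> \oo] --> \int[mu]_x f x.
Proof.
move=> mf ff ig fg.
have mf' : measurable_fun setT f by apply: (measurable_fun_cvg mf) => x _.
have [|||||] := @dominated_convergence _ _ _ mu setT measurableT
  (fun n x => (f_ n x)%:E) (fun x => (f x)%:E) (fun x => (g x)%:E).
- by move=> n; apply/measurable_EFinP.
- exact/measurable_EFinP.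
- by apply: aeW => x _; apply: cvg_EFin; [exact: nearW|exact: ff].
- exact: ig.
- by apply: aeW => x n _; rewrite lee_fin.
move=> If _ /=; rewrite -(fineK (integrable_fin_num measurableT If)).
by move=> /fine_cvg.
Qed.

End DominatedRintegral.

(** * Completeness of the real L^2 space *)

Section L2Complete.
Context d (T : measurableType d) (R : realType).
Variable mu : {finite_measure set T -> \bar R}.

Lemma sum_half_le2 n : \sum_(k < n) (2^-1 : R) ^+ k <= 2.
Proof.
suff -> : \sum_(k < n) (2^-1 : R) ^+ k = 2 - 2 * 2^-1 ^+ n.
  by rewrite lerBlDr lerDl mulr_ge0// exprn_ge0// invr_ge0.
elim: n => [|n ih]; first by rewrite big_ord0 expr0; ring.
by rewrite big_ord_recr /= ih exprS; field.
Qed.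

(** The increments are summable because [2 |w| <= 2^-k + 2^k w^2]: the weight
turns a bound on squares into a bound on absolute values, without
Cauchy-Schwarz for series. *)
Lemma cvgn_sum_sq (v : nat -> R) (M : R) :
  (forall n, \sum_(k < n) 2 ^+ k * (v k.+1 - v k) ^+ 2 <= M) -> cvgn v.
Proof.
move=> vM.
have E : v = (fun n => v 0%N + series (telescope v) n).
  by apply/funext => n; exact: eq_sum_telescope.
rewrite E; apply: is_cvgD; first exact: is_cvg_cst.
apply: normed_cvg.
have nd : nondecreasing_seq [normed series (telescope v)].
  by apply: nondecreasing_series => n _ _; exact: normr_ge0.
apply: nondecreasing_is_cvgn => //.
exists (1 + M / 2) => _ [n _ <-] /=.
rewrite seriesEord/=.
apply: le_trans (_ : \sum_(k < n) ((2^-1 : R) ^+ k +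
    2 ^+ k * (v k.+1 - v k) ^+ 2) / 2 <= _); last first.
  rewrite -mulr_suml big_split/=.
  by have := sum_half_le2 n; have := vM n; lra.
apply: ler_sum => k _; rewrite /telescope/=.
have := normr_ge0 (v k.+1 - v k); rewrite -[X in _ * X ^+ 2]/(v k.+1 - v k).
rewrite -[(v k.+1 - v k) ^+ 2]real_normK ?num_real//.
move: `|v k.+1 - v k| => x x0.
have P : 0 < (2 : R) ^+ k by rewrite exprn_gt0.
rewrite exprVn; move: P; move: (2 ^+ k) => q q0.
have : 0 <= (q^-1) * (1 - q * x) ^+ 2 by rewrite mulr_ge0 ?sqr_ge0 ?invr_ge0 ?ltW.
rewrite (_ : _ * _ = q^-1 + q * x ^+ 2 - 2 * x); first by lra.
by field; rewrite gt_eqF.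
Qed.

(** When the squared increments decrease like [4^-k], the weighted series
[\sum_k 2^k (v_(k+1) - v_k)^2] has a finite integral, so it is finite almost
everywhere and [cvgn_sum_sq] applies. *)
Lemma sq_integrable_fast_cvg (v : nat -> T -> R) :
  (forall k, sq_integrable mu (v k)) ->
  (forall k, sqn mu (fun x => v k.+1 x - v k x) <= 4^-1 ^+ k) ->
  exists2 g : T -> R, measurable_fun setT g &
    {ae mu, forall x, v ^~ x @ \oo --> g x}.
Proof.
move=> sv vs.
pose w k x := 2 ^+ k * (v k.+1 x - v k x) ^+ 2.
have sB k : sq_integrable mu (fun x => v k.+1 x - v k x) by exact: sq_integrableB.
have mw k : measurable_fun setT (fun x => (w k x)%:E).
  by apply/measurable_EFinP; apply: measurable_funM => //;
    apply: measurable_funX; case: (sB k).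
have w0 k x : 0 <= w k x by rewrite mulr_ge0 ?sqr_ge0// exprn_ge0.
pose h x := (\sum_(k <oo) (w k x)%:E)%E.
have mh : measurable_fun setT h.
  by apply: ge0_emeasurable_sum => // k x _ _; rewrite lee_fin.
have h0 x : (0 <= h x)%E by apply: nneseries_ge0 => k _ _; rewrite lee_fin.
have iw k : (\int[mu]_x (w k x)%:E <= (2^-1 ^+ k)%:E)%E.
  under eq_integral do rewrite EFinM.
  rewrite integralZl//; last by case: (sB k).
  rewrite EFin_sqn// -EFinM lee_fin.
  apply: le_trans (ler_wpM2l _ (vs k)) _; first by rewrite exprn_ge0.
  by rewrite -exprMn (_ : 2 * 4^-1 = 2^-1)//; field.
have ih : (\int[mu]_x h x <= 2%:E)%E.
  rewrite integral_nneseries//; last by move=> k x _; rewrite lee_fin.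
  apply: le_trans (_ : \sum_(k <oo) (2^-1 ^+ k)%:E <= _)%E.
    apply: lee_nneseries => k *; last exact: iw.
    by apply: integral_ge0 => x _; rewrite lee_fin.
  apply: lime_le.
    by apply: is_cvg_nneseries => k _ _; rewrite lee_fin exprn_ge0// invr_ge0.
  apply: nearW => n; rewrite sumEFin lee_fin big_mkord.
  exact: sum_half_le2.
have hfin : mu.-integrable setT h.
  apply/integrableP; split=> //.
  under eq_integral do rewrite gee0_abs//.
  by rewrite (le_lt_trans ih)// ltry.
pose D := [set x | (h x < +oo)%E].
have mD : measurable D.
  by rewrite -[D]setTI; exact: emeasurable_fun_infty_o.
have aeD : {ae mu, forall x, D x}.
  apply: filterS (integrable_ae measurableT hfin) => x /(_ I).
  by rewrite ge0_fin_numE.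
have cD x : D x -> cvgn (v ^~ x).
  move=> Dx; apply: (@cvgn_sum_sq _ (fine (h x))) => n.
  rewrite -lee_fin fineK ?ge0_fin_numE//.
  rewrite -sumEFin -(big_mkord xpredT (fun k => (w k x)%:E)).
  by apply: nneseries_lim_ge => k _ _; rewrite lee_fin.
(* Killing the sequence outside D makes it converge everywhere, so that its
limit is measurable. *)
pose vD k x := v k x * \1_D x.
have cvD x : cvgn (vD ^~ x).
  have [/cD h1|nDx] := pselect (D x).
    by apply: is_cvgM => //; exact: is_cvg_cst.
  rewrite (_ : vD ^~ x = cst 0); first exact: is_cvg_cst.
  by apply/funext => k; rewrite /vD indicE memNset// mulr0.
exists (fun x => limn (vD ^~ x)).
  apply: (@measurable_fun_cvg _ _ _ _ vD) => // k.
  by apply: measurable_funM => //; case: (sv k).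
apply: filterS aeD => x Dx.
rewrite [X in X @ _ --> _](_ : _ = vD ^~ x); first exact: cvD.
by apply/funext => k; rewrite /vD indicE mem_set// mulr1.
Qed.

(** Extract a subsequence that converges almost everywhere; Fatou's lemma
along it gives both the integrability of the limit and the convergence in norm
of the whole sequence. *)
Lemma sq_integrable_complete (u : nat -> T -> R) :
  (forall n, sq_integrable mu (u n)) ->
  (forall e : R, 0 < e -> exists N, forall m n, (N <= m)%N -> (N <= n)%N ->
     sqn mu (fun x => u m x - u n x) <= e) ->
  exists2 g, sq_integrable mu g &
    forall e : R, 0 < e -> exists N, forall n, (N <= n)%N ->
      sqn mu (fun x => u n x - g x) <= e.
Proof.
move=> su cu.
have p4 k : 0 < (4^-1 : R) ^+ k by rewrite exprn_gt0// invr_gt0.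
have [N NP] := choice (fun k => cu _ (p4 k)).
(* The maximum makes the chosen indices nondecreasing, and the term k makes
them unbounded. *)
pose n_ k : nat := (\max_(i < k.+1) N i + k)%N.
have Nn k : (N k <= n_ k)%N.
  by rewrite /n_ (leq_trans _ (leq_addr _ _))// (leq_bigmax (ord_max : 'I_k.+1)).
have nS k : (n_ k <= n_ k.+1)%N.
  by rewrite /n_ [in leqRHS]big_ord_recr/= leq_add ?leq_maxl.
pose v k := u (n_ k).
have [g mg gP] : exists2 g : T -> R, measurable_fun setT g &
    {ae mu, forall x, v ^~ x @ \oo --> g x}.
  apply: sq_integrable_fast_cvg => k; first exact: su.
  by apply: (NP k (n_ k.+1) (n_ k)); rewrite // (leq_trans (Nn k)).
have key e K : (forall m n, (K <= m)%N -> (K <= n)%N ->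
     sqn mu (fun x => u m x - u n x) <= e) -> forall n, (K <= n)%N ->
     sq_integrable mu (fun x => u n x - g x) /\
     sqn mu (fun x => u n x - g x) <= e.
  move=> He n Kn.
  apply: (@fatou_sq _ _ _ mu (fun k x => u n x - v (k + K)%N x)).
  - by move=> k; exact: sq_integrableB (su n) (su _).
  - move=> k; apply: (He n (n_ (k + K))) => //.
    exact: leq_trans (leq_addl k K) (leq_addl _ _).
  - by apply: measurable_funB => //; case: (su n).
  - apply: filterS gP => x gx; apply: cvgB; first exact: cvg_cst.
    by move: gx; rewrite -(cvg_shiftn K).
have [K0 /key HK0] := cu 1 ltr01.
have sg : sq_integrable mu g.
  have [s0 _] := HK0 K0 (leqnn _).
  have := sq_integrableB (su K0) s0.
  by under eq_fun do rewrite subKr.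
exists g => // e e0; have [K /key HK] := cu e e0.
by exists K => n /HK[].
Qed.

End L2Complete.

(** * Multi-indices and prime factorizations *)

(** All sums and products over supports are moved to a common index list by
this lemma: terms outside the support are neutral. *)
Lemma big_finsupp_seq (K : choiceType) (V : eqType) (x0 : V)
    (f : {fsfun K -> V with x0}) (S : Type) (idx : S) (op : Monoid.com_law idx)
    (F : K -> V -> S) (r : seq K) :
  uniq r -> (forall k, F k x0 = idx) -> {subset finsupp f <= r} ->
  \big[op/idx]_(k <- finsupp f) F k (f k) = \big[op/idx]_(k <- r) F k (f k).
Proof.
move=> ur F0 fr; rewrite [RHS](bigID (fun k => k \in finsupp f))/=.
rewrite [X in op _ X]big1 ?Monoid.mulm1; last first.
  by move=> k; rewrite memNfinsupp => /eqP->.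
rewrite -[RHS]big_filter; apply: perm_big.
apply: uniq_perm; rewrite ?filter_uniq ?fset_uniq// => k.
by rewrite mem_filter; case: (boolP (k \in _)) => //= /fr ->.
Qed.

Section Multiindex.
Implicit Types (kappa lambda : multiindex) (d M : nat).

Lemma big_finsupp (S : Type) (idx : S) (op : Monoid.com_law idx)
    (F : nat -> nat -> S) kappa d :
  (forall j, F j 0%N = idx) -> (forall j, (d <= j)%N -> kappa j = 0%N) ->
  \big[op/idx]_(j <- finsupp kappa) F j (kappa j) =
  \big[op/idx]_(j < d) F j (kappa j).
Proof.
move=> F0 kd; rewrite -(big_mkord xpredT (fun j => F j (kappa j))).
apply: big_finsupp_seq => //; first exact: iota_uniq.
move=> j; rewrite mem_index_iota mem_finsupp /=; case: ltnP => // /kd ->.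
by rewrite eqxx.
Qed.

Lemma multiindex_bounded kappa :
  exists2 d, (forall j, (d <= j)%N -> kappa j = 0%N) &
    forall j, (kappa j < d)%N.
Proof.
exists (\max_(j <- finsupp kappa) maxn j.+1 (kappa j).+1).+1 => j.
  rewrite ltnNge => /negP jd; apply/eqP; rewrite -memNfinsupp.
  apply/negP => js; apply: jd.
  by rewrite (leq_trans _ (leq_bigmax_seq _ js isT))//= leq_max leqnSn.
have [js|] := boolP (j \in finsupp kappa).
  rewrite ltnS; apply: leq_trans (leq_bigmax_seq _ js isT).
  by rewrite /= leq_max leqnSn orbT.
by rewrite memNfinsupp => /eqP ->.
Qed.

Lemma multiindices_bounded (r : seq multiindex) :
  exists d, forall kappa, kappa \in r ->
    (forall j, (d <= j)%N -> kappa j = 0%N) /\ (forall j, (kappa j < d)%N).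
Proof.
elim: r => [|k r [d dP]]; first by exists 0%N.
have [e e1 e2] := multiindex_bounded k; exists (maxn d e) => kappa.
rewrite inE => /predU1P[->|/dP[d1 d2]]; split => j.
- by rewrite geq_max => /andP[_ /e1].
- by rewrite leq_max e2 orbT.
- by rewrite geq_max => /andP[/d1].
- by rewrite leq_max d2.
Qed.

Definition multiindex_add kappa lambda : multiindex :=
  [fsfun j in (finsupp kappa `|` finsupp lambda)%fset => (kappa j + lambda j)%N].

Lemma multiindex_addE kappa lambda j :
  multiindex_add kappa lambda j = (kappa j + lambda j)%N.
Proof.
rewrite fsfunE inE !mem_finsupp.
by case: eqP => [->|]//=; case: eqP => [->|].
Qed.

(** Finite functions index the terms of an expanded product of sums (see
[prod_sum_box]); this is the corresponding multi-index, extended by zero. *)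
Definition multiindex_of_ffun M d (phi : {ffun 'I_d -> 'I_M}) : multiindex :=
  [fsfun j in seq_fset tt (iota 0 d) =>
     if insub j is Some i then phi i : nat else 0%N].

Lemma multiindex_of_ffunE M d (phi : {ffun 'I_d -> 'I_M}) (i : 'I_d) :
  multiindex_of_ffun phi i = phi i.
Proof. by rewrite fsfunE seq_fsetE mem_iota/= ltn_ord valK. Qed.

Lemma multiindex_of_ffun0 M d (phi : {ffun 'I_d -> 'I_M}) j :
  (d <= j)%N -> multiindex_of_ffun phi j = 0%N.
Proof. by move=> dj; rewrite fsfunE seq_fsetE mem_iota/= add0n ltnNge dj. Qed.

Lemma multiindex_of_ffun_inj M d : injective (@multiindex_of_ffun M d).
Proof.
move=> phi psi E; apply/ffunP => i; apply: val_inj => /=.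
by rewrite -!multiindex_of_ffunE E.
Qed.

(** The multi-indices carried by the first [d] coordinates with entries below
[M]. For finite sums the boxes play the role of all multi-indices in the first
[d] variables. *)
Definition box M d : seq multiindex :=
  [seq multiindex_of_ffun phi | phi <- enum {: {ffun 'I_d -> 'I_M}}].

Lemma box_uniq M d : uniq (box M d).
Proof. by rewrite map_inj_uniq ?enum_uniq//; exact: multiindex_of_ffun_inj. Qed.

Lemma mem_box M d kappa : (forall j, (d <= j)%N -> kappa j = 0%N) ->
  (forall j, (kappa j < M)%N) -> kappa \in box M d.
Proof.
move=> kd kM; apply/mapP; exists [ffun i : 'I_d => Ordinal (kM i)].
  by rewrite mem_enum.
apply/fsfunP => j; have [jd|dj] := ltnP j d.
  by rewrite (multiindex_of_ffunE _ (Ordinal jd)) ffunE.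
by rewrite kd// multiindex_of_ffun0.
Qed.

Lemma box_supp M d kappa j : kappa \in box M d -> (d <= j)%N -> kappa j = 0%N.
Proof. by move=> /mapP[phi _ ->]; exact: multiindex_of_ffun0. Qed.

Lemma box_bound M d kappa j : kappa \in box M d -> (0 < M)%N -> (kappa j < M)%N.
Proof.
move=> /mapP[phi _ ->] M0; have [jd|dj] := ltnP j d.
  by rewrite (multiindex_of_ffunE phi (Ordinal jd)).
by rewrite multiindex_of_ffun0.
Qed.

Lemma sub_box M d d' : (d <= d')%N -> (0 < M)%N -> {subset box M d <= box M d'}.
Proof.
move=> dd' M0 kappa kb; apply: mem_box => j; last by apply: box_bound kb M0.
by move=> d'j; apply: box_supp kb (leq_trans dd' d'j).
Qed.

Lemma prod_sum_box (R : comPzRingType) (x : nat -> R) M d :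
  \prod_(j < d) \sum_(n < M) x j ^+ n =
  \sum_(kappa <- box M d) \prod_(j < d) x j ^+ kappa j.
Proof.
rewrite bigA_distr_bigA /box big_map big_enum /=; apply: eq_bigr => phi _.
by apply: eq_bigr => i _; rewrite multiindex_of_ffunE.
Qed.

End Multiindex.

Section PrimeMonomial.
Implicit Types kappa lambda : multiindex.

Lemma nth_prime_prime j : prime (nth_prime j).
Proof.
case: j => // j; rewrite /nth_prime iterS /next_prime.
by case: ex_minnP => p /andP[].
Qed.

Lemma nth_prime_lt j : (nth_prime j < nth_prime j.+1)%N.
Proof.
rewrite /nth_prime iterS; set m := iter _ _ _; rewrite /next_prime.
by case: ex_minnP => p /andP[].
Qed.

Lemma nth_prime_inj : injective nth_prime.
Proof.
apply: (@incn_inj nth_prime); apply: leq_mono.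
by apply: homo_ltn => [? ? ?|i]; [exact: ltn_trans|exact: nth_prime_lt].
Qed.

Lemma nth_prime_gt j : (j < nth_prime j)%N.
Proof. by elim: j => // j ih; rewrite (leq_ltn_trans ih)// nth_prime_lt. Qed.

(** The first [nth_prime j] that reaches [p] cannot exceed it, because
[next_prime] returns the least prime above the previous one. *)
Lemma nth_prime_surj p : prime p -> exists j, nth_prime j = p.
Proof.
move=> pp; have ex : exists j, (p <= nth_prime j)%N.
  by exists p; rewrite ltnW// nth_prime_gt.
case: (ex_minnP ex) => -[|j] pj jmin.
  by exists 0%N; apply/eqP; rewrite eqn_leq pj prime_gt1.
have jp : (nth_prime j < p)%N.
  by rewrite ltnNge; apply/negP => /jmin; rewrite ltnn.
exists j.+1; apply/eqP; rewrite eqn_leq pj andbT.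
rewrite /nth_prime iterS -/(nth_prime j) /next_prime.
by case: ex_minnP => q _; apply; rewrite jp.
Qed.

Lemma prime_monomialE kappa d : (forall j, (d <= j)%N -> kappa j = 0%N) ->
  prime_monomial kappa = (\prod_(j < d) nth_prime j ^ kappa j)%N.
Proof. by apply: (@big_finsupp _ _ _ (fun j n => nth_prime j ^ n)%N). Qed.

Lemma prime_monomial_gt0 kappa : (0 < prime_monomial kappa)%N.
Proof.
by apply: prodn_gt0 => j; rewrite expn_gt0 prime_gt0// nth_prime_prime.
Qed.

Lemma prime_monomialD kappa lambda :
  prime_monomial (multiindex_add kappa lambda) =
  (prime_monomial kappa * prime_monomial lambda)%N.
Proof.
have [d dP] := multiindices_bounded [:: kappa; lambda].
have [k1 _] := dP kappa (mem_head _ _).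
have [l1 _] := dP lambda (mem_last kappa [:: lambda]).
rewrite !(@prime_monomialE _ d)//; last first.
  by move=> j dj; rewrite multiindex_addE k1// l1.
rewrite -big_split; apply: eq_bigr => j _.
by rewrite multiindex_addE expnD.
Qed.

Lemma logn_prime_monomial kappa j :
  logn (nth_prime j) (prime_monomial kappa) = kappa j.
Proof.
have [d kd _] := multiindex_bounded kappa.
rewrite (@prime_monomialE _ (d + j.+1)); last first.
  by move=> i di; rewrite kd// (leq_trans _ di)// leq_addr.
have jd : (j < d + j.+1)%N by rewrite addnS ltnS leq_addl.
rewrite (bigD1 (Ordinal jd))//= lognM; last 2 first.
- by rewrite expn_gt0 prime_gt0// nth_prime_prime.
- by apply: prodn_gt0 => i; rewrite expn_gt0 prime_gt0// nth_prime_prime.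
rewrite pfactorK ?nth_prime_prime// [X in (_ + X)%N](_ : _ = 0%N) ?addn0//.
apply: (big_rec (fun n => logn (nth_prime j) n = 0%N)); first exact: logn1.
move=> i x ij lx; have [->|x0] := posnP x; first by rewrite muln0 logn0.
rewrite lognM// ?expn_gt0 ?prime_gt0 ?nth_prime_prime// lx addn0 lognX.
rewrite logn_prime ?nth_prime_prime//.
case: eqP => [/nth_prime_inj E|]; last by rewrite muln0.
by case/eqP: ij; apply: val_inj.
Qed.

(** The indices are cut off at [n] because [nth_prime j > j]: no prime of
larger index divides [n]. *)
Definition prime_exponents (n : nat) : multiindex :=
  [fsfun j in seq_fset tt (iota 0 n) => logn (nth_prime j) n].

Lemma prime_exponentsE n j : prime_exponents n j = logn (nth_prime j) n.
Proof.
rewrite fsfunE seq_fsetE mem_iota/= add0n; case: ltnP => // nj.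
have [->|n0] := posnP n; first by rewrite logn0.
apply/esym/eqP; rewrite -leqn0 leqNgt logn_gt0 mem_primes.
apply/negP => /and3P[_ _ /dvdn_leq]; rewrite n0 => /(_ isT).
by rewrite leqNgt (leq_ltn_trans nj)// nth_prime_gt.
Qed.

Lemma prime_monomialK : cancel prime_monomial prime_exponents.
Proof.
by move=> kappa; apply/fsfunP => j; rewrite prime_exponentsE logn_prime_monomial.
Qed.

Lemma prime_exponentsK n : (0 < n)%N -> prime_monomial (prime_exponents n) = n.
Proof.
move=> n0; apply: eqn_from_log => //; first exact: prime_monomial_gt0.
move=> p; have [pp|np] := boolP (prime p); last by rewrite /logn (negbTE np).
have [j <-] := nth_prime_surj pp.
by rewrite logn_prime_monomial prime_exponentsE.
Qed.

End PrimeMonomial.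

(** * Monomials and truncated Szego kernels on the cube *)

Section CubeMonomials.
Context (R : realType).
Implicit Types (s t : borel_cube R) (kappa lambda : multiindex).

Lemma cube_coord_lt1 t j : `|cube_coord t j| < 1.
Proof.
rewrite /cube_coord; case: (t j) => x x1; rewrite set_valE /= ltr_norml.
by move: x1; rewrite inE/= in_itv.
Qed.

(** Coordinates are continuous for the product topology, and the sigma-algebra
is the one generated by the open sets. *)
Lemma measurable_cube_coord j :
  measurable_fun setT (fun t : borel_cube R => cube_coord t j).
Proof.
apply: (measurability _ (RGenOpens.measurableE R)) => _ [_ [a [b ->] <-]].
have oA : open (`]a, b[%classic : set R) by exact: interval_open.
rewrite setTI; apply: sub_sigma_algebra.
have c1 : continuous (fun t : cube R => t j).
  by move=> t; exact: (@proj_continuous nat (fun=> open_unit R) j t).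
have c2 : continuous (set_val : open_unit R -> R) by exact: initial_continuous.
exact: ((continuousP _).1 c1 _ ((continuousP _).1 c2 _ oA)).
Qed.

Lemma measurable_monomial kappa :
  measurable_fun setT (fun t : borel_cube R => monomial t kappa).
Proof.
by apply: measurable_prod => j _; apply: measurable_funX;
   exact: measurable_cube_coord.
Qed.

Lemma monomialE t kappa d : (forall j, (d <= j)%N -> kappa j = 0%N) ->
  monomial t kappa = \prod_(j < d) cube_coord t j ^+ kappa j.
Proof. by apply: (@big_finsupp _ _ _ (fun j n => cube_coord t j ^+ n)). Qed.

Lemma monomialD t kappa lambda :
  monomial t (multiindex_add kappa lambda) = monomial t kappa * monomial t lambda.
Proof.
have [d dP] := multiindices_bounded [:: kappa; lambda].
have [k1 _] := dP kappa (mem_head _ _).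
have [l1 _] := dP lambda (mem_last kappa [:: lambda]).
rewrite !(@monomialE _ _ d)//; last first.
  by move=> j dj; rewrite multiindex_addE k1// l1.
rewrite -big_split; apply: eq_bigr => j _.
by rewrite multiindex_addE exprD.
Qed.

Lemma monomial_le1 t kappa : `|monomial t kappa| <= 1.
Proof.
rewrite normr_prod; apply: prodr_ile1 => j _.
by rewrite normr_ge0/= normrX exprn_ile1// ltW// cube_coord_lt1.
Qed.

Definition mpoly (r : seq multiindex) (c : multiindex -> R) t : R :=
  \sum_(kappa <- r) c kappa * monomial t kappa.

(** The Szego kernel with each geometric series cut at [M] terms. By
[trunc_kernelE] it is a finite sum of products [s^kappa t^kappa], which makes
the associated operator of finite rank. *)
Definition trunc_kernel (M d : nat) s t : R :=
  \prod_(j < d) \sum_(n < M) (cube_coord s j * cube_coord t j) ^+ n.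

Lemma trunc_kernelE M d s t : trunc_kernel M d s t =
  \sum_(kappa <- box M d) monomial s kappa * monomial t kappa.
Proof.
rewrite /trunc_kernel.
rewrite (prod_sum_box (fun j => cube_coord s j * cube_coord t j)).
rewrite !big_seq; apply: eq_bigr => kappa kb.
have kd j : (d <= j)%N -> kappa j = 0%N by apply: box_supp kb.
rewrite !(@monomialE _ _ d)// -big_split.
by apply: eq_bigr => j _; rewrite exprMn.
Qed.

Lemma coordM_lt1 s t j : `|cube_coord s j * cube_coord t j| < 1.
Proof. by rewrite normrM mulr_ilt1// cube_coord_lt1. Qed.

Lemma szego_factor_gt0 s t j : 0 < 1 - cube_coord s j * cube_coord t j.
Proof. by rewrite subr_gt0 ltr_normlW// coordM_lt1. Qed.

Lemma trunc_kernel_cvg d s t :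
  trunc_kernel M d s t @[M --> \oo] --> szego_kernel d s t.
Proof.
rewrite /trunc_kernel /szego_kernel; elim: d => [|d ih].
  rewrite big_ord0; under eq_fun do rewrite big_ord0; exact: cvg_cst.
rewrite big_ord_recr/=; under eq_fun do rewrite big_ord_recr/=.
apply: cvgM => //.
have := @cvg_geometric_series _ 1 _ (coordM_lt1 s t d); rewrite mul1r.
rewrite (_ : series _ = (fun M => \sum_(n < M)
  (cube_coord s d * cube_coord t d) ^+ n)); first by [].
rewrite seriesEord; apply/funext => M.
by apply: eq_bigr => i _; rewrite /geometric/= mul1r.
Qed.

(** Each factor is [(1 - x^M) / (1 - x)] with [|x| < 1]. The point is to
dominate by the Szego kernel itself, which is positive even where the
coordinates are negative; a termwise bound would give the kernel of the
absolute values of the coordinates, over which (3) gives no control. *)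
Lemma trunc_kernel_le M d s t :
  `|trunc_kernel M d s t| <= 2 ^+ d * szego_kernel d s t.
Proof.
have -> : (2 : R) ^+ d = \prod_(j < d) 2 by rewrite prodr_const card_ord.
rewrite /trunc_kernel /szego_kernel -big_split/= normr_prod.
apply: ler_prod => j _; rewrite normr_ge0 /=.
have x1 := coordM_lt1 s t j; have x0 := szego_factor_gt0 s t j.
move: x1 x0; move: (cube_coord s j * cube_coord t j) => x x1 x0.
have -> : \sum_(n < M) x ^+ n = (1 - x ^+ M) / (1 - x).
  apply: (canRL (mulfK _)); first by rewrite gt_eqF.
  by rewrite -[RHS]opprB subrX1; ring.
rewrite normrM [X in _ * X]ger0_norm ?invr_ge0 ?(ltW x0)//.
rewrite ler_wpM2r ?invr_ge0 ?(ltW x0)//.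
rewrite (le_trans (ler_normB _ _))// normr1 -[leRHS]/(1 + 1) lerD2l.
by rewrite normrX exprn_ile1// ltW.
Qed.

(** For fixed [t] the kernel is bounded in [s], so [Gop] is given by a
convergent integral at every point and not only almost everywhere. *)
Lemma szego_kernel_le d s t :
  `|szego_kernel d s t| <= \prod_(j < d) (1 - `|cube_coord t j|)^-1.
Proof.
rewrite /szego_kernel normr_prod; apply: ler_prod => j _; rewrite normr_ge0/=.
have t1 := cube_coord_lt1 t j; have s1 := cube_coord_lt1 s j.
rewrite ger0_norm ?invr_ge0 ?(ltW (szego_factor_gt0 _ _ _))//.
rewrite lef_pV2 ?posrE ?subr_gt0//; last first.
  by rewrite ltr_normlW// coordM_lt1.
rewrite lerD2l lerN2 (le_trans (ler_norm _))// normrM.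
by rewrite ler_piMl// ltW.
Qed.

Lemma measurable_trunc_kernel M d t :
  measurable_fun setT (fun s : borel_cube R => trunc_kernel M d s t).
Proof.
under eq_fun do rewrite trunc_kernelE.
by apply: measurable_sum => kappa; apply: measurable_funM => //;
   exact: measurable_monomial.
Qed.

Lemma measurable_szego_kernel d t :
  measurable_fun setT (fun s : borel_cube R => szego_kernel d s t).
Proof.
apply: (@measurable_fun_cvg _ _ _ _ (fun M s => trunc_kernel M d s t)).
  by move=> M; exact: measurable_trunc_kernel.
by move=> s _; exact: trunc_kernel_cvg.
Qed.

End CubeMonomials.

(** * The real form of the operators G_d *)

Section RealOperators.
Context (R : realType).
Variable mu : {finite_measure set (borel_cube R) -> \bar R}.
Implicit Types (u v : borel_cube R -> R) (t : borel_cube R).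
Implicit Types (c e : multiindex -> R) (r q : seq multiindex).

Let sqi := sq_integrable mu.

Lemma sq_integrable_monomial kappa : sqi (fun t => monomial t kappa).
Proof.
apply: (@sq_integrable_bounded _ _ _ _ _ 1); first exact: measurable_monomial.
by move=> t; exact: monomial_le1.
Qed.

Lemma sq_integrable_mpoly r c : sqi (mpoly r c).
Proof. by apply: sq_integrable_sum => kappa; exact: sq_integrable_monomial. Qed.

Lemma sq_integrable_szego d t : sqi (fun s => szego_kernel d s t).
Proof.
apply: (sq_integrable_bounded _ (measurable_szego_kernel d t)) => s.
exact: szego_kernel_le.
Qed.

Lemma sq_integrable_norm u : sqi u -> sqi (fun t => `|u t|).
Proof.
move=> [mu1 iu]; split; first exact: measurableT_comp.
by under eq_fun do rewrite real_normK ?num_real//.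
Qed.

(** The coefficients of the adjoint of [mpoly], which maps functions to
families indexed by the multi-indices. *)
Definition moment u kappa : R := \int[mu]_s (monomial s kappa * u s).

Lemma Rintegral_sum (I : Type) (r : seq I) (c : I -> R)
    (f : I -> borel_cube R -> R) :
  (forall i, mu.-integrable setT (EFin \o f i)) ->
  \int[mu]_x (\sum_(i <- r) c i * f i x) = \sum_(i <- r) c i * \int[mu]_x f i x.
Proof.
move=> fi; elim: r => [|i r ih].
  rewrite big_nil; under eq_Rintegral do rewrite big_nil.
  by rewrite Rintegral_cst// mul0r.
rewrite big_cons -ih -RintegralZl// -RintegralD//.
- by under eq_Rintegral do rewrite big_cons.
- exact: (integrableZl measurableT (c i) (fi i)).
- under [X in _.-integrable _ X]eq_fun do rewrite /= -sumEFin.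
  by apply: integrable_sum => // k _; exact: (integrableZl measurableT (c k) (fi k)).
Qed.

Lemma Rintegral_mpolyM r c u : sqi u ->
  \int[mu]_t (mpoly r c t * u t) = \sum_(kappa <- r) c kappa * moment u kappa.
Proof.
move=> su; rewrite -Rintegral_sum; last first.
  by move=> kappa; apply: integrableM_sq => //; exact: sq_integrable_monomial.
apply: eq_Rintegral => t _; rewrite /mpoly mulr_suml.
by apply: eq_bigr => kappa _; rewrite mulrA.
Qed.

Lemma moment_mpoly r c kappa :
  moment (mpoly r c) kappa =
  \sum_(lambda <- r) c lambda * \int[mu]_t monomial t (multiindex_add kappa lambda).
Proof.
rewrite /moment; under eq_Rintegral do rewrite mulrC.
rewrite Rintegral_mpolyM; last exact: sq_integrable_monomial.
apply: eq_bigr => lambda _; congr (_ * _).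
by apply: eq_Rintegral => t _; rewrite monomialD mulrC.
Qed.

(** The kernel is real, so [Gop] acts separately on real and imaginary parts,
on each of them by [Greal]. *)
Definition Greal (d : nat) u t : R := \int[mu]_s (szego_kernel d s t * u s).

(** The operator [A P A^*], for [A] the map from coefficients to polynomials
and [P] the projection onto the coefficients in a box; [GtruncE] identifies it
with the operator of the truncated kernel. *)
Definition Gtrunc (M d : nat) u : borel_cube R -> R :=
  mpoly (box M d) (moment u).

Lemma GtruncE M d u t : sqi u ->
  Gtrunc M d u t = \int[mu]_s (trunc_kernel M d s t * u s).
Proof.
move=> su; rewrite /Gtrunc /mpoly.
under eq_bigr do rewrite mulrC.
rewrite -(Rintegral_mpolyM _ (fun kappa => monomial t kappa))//.
apply: eq_Rintegral => s _; rewrite trunc_kernelE /mpoly; congr (_ * _).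
by apply: eq_bigr => kappa _; rewrite mulrC.
Qed.

Lemma integrable_szegoM d t u : sqi u ->
  mu.-integrable setT (fun s => (szego_kernel d s t * u s)%:E).
Proof. by move=> su; apply: integrableM_sq => //; exact: sq_integrable_szego. Qed.

Lemma integrable_szego_dom d t u : sqi u ->
  mu.-integrable setT (fun s => (2 ^+ d * (szego_kernel d s t * `|u s|))%:E).
Proof.
move=> su; have iu := integrable_szegoM d t (sq_integrable_norm su).
exact: (integrableZl measurableT (2 ^+ d) iu).
Qed.

Lemma trunc_kernelM_le M d s t u :
  `|trunc_kernel M d s t * u s| <= 2 ^+ d * (szego_kernel d s t * `|u s|).
Proof. by rewrite normrM mulrA ler_wpM2r// trunc_kernel_le. Qed.

Lemma Gtrunc_cvg d u t : sqi u -> Gtrunc M d u t @[M --> \oo] --> Greal d u t.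
Proof.
move=> su; under eq_fun do rewrite GtruncE//.
apply: (@dominated_Rintegral_cvg _ _ _ mu
    (fun M s => trunc_kernel M d s t * u s) (fun s => szego_kernel d s t * u s) _ _ _
    (integrable_szego_dom d t su)).
- move=> M; apply: measurable_funM; first exact: measurable_trunc_kernel.
  by case: su.
- by move=> s; apply: cvgM; [exact: trunc_kernel_cvg|exact: cvg_cst].
- by move=> M s; exact: trunc_kernelM_le.
Qed.

Lemma Gtrunc_le M d u t : sqi u ->
  `|Gtrunc M d u t| <= 2 ^+ d * Greal d (fun s => `|u s|) t.
Proof.
move=> su; rewrite GtruncE//.
have iu := integrable_szego_dom d t su.
have mk : measurable_fun setT (fun s => trunc_kernel M d s t * u s).
  apply: measurable_funM; first exact: measurable_trunc_kernel.
  by case: su.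
have it : mu.-integrable setT (fun s => (trunc_kernel M d s t * u s)%:E).
  apply: (le_integrable measurableT _ _ iu); first exact/measurable_EFinP.
  move=> s _; rewrite !abse_EFin lee_fin (le_trans (trunc_kernelM_le _ _ _ _ _))//.
  exact: ler_norm.
apply: le_trans (le_normr_Rintegral measurableT it) _.
rewrite /Greal -RintegralZl//; last exact: integrable_szegoM (sq_integrable_norm su).
apply: le_Rintegral => //.
  apply: (le_integrable measurableT _ _ it).
    by apply/measurable_EFinP; exact: measurableT_comp.
  by move=> s _; rewrite !abse_EFin lee_fin normr_id.
by move=> s _; exact: trunc_kernelM_le.
Qed.

Lemma measurable_Greal d u : sqi u -> measurable_fun setT (Greal d u).
Proof.
move=> su; apply: (@measurable_fun_cvg _ _ _ _ (fun M => Gtrunc M d u)).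
  by move=> M; have [] := sq_integrable_mpoly (box M d) (moment u).
by move=> t _; exact: Gtrunc_cvg.
Qed.

Lemma Greal_lin d (a : R) u v t : sqi u -> sqi v ->
  Greal d (fun s => a * u s + v s) t = a * Greal d u t + Greal d v t.
Proof.
move=> su sv; rewrite /Greal -RintegralZl//; last exact: integrable_szegoM.
rewrite -RintegralD//; last 2 first.
- exact: (integrableZl measurableT a (integrable_szegoM d t su)).
- exact: integrable_szegoM.
by apply: eq_Rintegral => s _; ring.
Qed.

(** The Carleson condition for real polynomials, with the support listed
without repetition. *)
Definition carleson_le (C : R) : Prop := forall r c, uniq r ->
  sqn mu (mpoly r c) <= C * \sum_(kappa <- r) c kappa ^+ 2.

(** Duality: with [S] the sum on the left, testing [u] against the polynomial
whose coefficients are the moments of [u] gives [S] itself, and Cauchy-Schwarz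
with the Carleson bound yields [S^2 <= C S sqn u]. *)
Lemma moment_bessel C r u : 0 <= C -> carleson_le C -> uniq r -> sqi u ->
  \sum_(kappa <- r) moment u kappa ^+ 2 <= C * sqn mu u.
Proof.
move=> C0 HC ur su; have := HC r (moment u) ur.
have := cauchy_schwarz_sq (sq_integrable_mpoly r (moment u)) su.
rewrite Rintegral_mpolyM//.
rewrite (eq_bigr (fun k => moment u k ^+ 2)); last by move=> k _; rewrite expr2.
have S0 : 0 <= \sum_(k <- r) moment u k ^+ 2 by apply: sumr_ge0 => k _; exact: sqr_ge0.
have U0 := sqn_ge0 mu u.
move: S0 U0; move: (\sum_(_ <- _) _) (sqn mu u) (sqn mu _) => S U P S0 U0 SP PC.
have [->|Sn0] := eqVneq S 0; first by rewrite mulr_ge0.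
rewrite -(ler_pM2l (_ : 0 < S)) ?lt0r ?Sn0//.
by rewrite -expr2 (le_trans SP)// mulrCA mulrA ler_wpM2r// mulrC.
Qed.

Lemma Gtrunc_sub M d d' u t : (d <= d')%N -> (0 < M)%N ->
  Gtrunc M d' u t - Gtrunc M d u t =
  mpoly [seq kappa <- box M d' | kappa \notin box M d] (moment u) t.
Proof.
move=> dd M0; rewrite /Gtrunc /mpoly (bigID (fun k => k \in box M d))/=.
rewrite addrC big_filter -[RHS]addr0 -addrA; congr (_ + _).
rewrite -big_filter (perm_big (box M d)) ?subrr//.
apply: uniq_perm; rewrite ?filter_uniq ?box_uniq// => k.
rewrite mem_filter; case: (boolP (k \in box M d)) => //= kb.
by rewrite (sub_box dd M0 kb).
Qed.

Section Bounded.
Variables (C : R) (C0 : 0 <= C) (HC : carleson_le C).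

Lemma sqn_Gtrunc_le M d u : sqi u -> sqn mu (Gtrunc M d u) <= C ^+ 2 * sqn mu u.
Proof.
move=> su; apply: le_trans (HC _ (box_uniq M d)) _.
by rewrite expr2 -mulrA ler_wpM2l// moment_bessel// box_uniq.
Qed.

(** The bound is uniform in the truncation, and so survives the pointwise
limit by Fatou's lemma. *)
Lemma Greal_bounded d u : sqi u ->
  sqi (Greal d u) /\ sqn mu (Greal d u) <= C ^+ 2 * sqn mu u.
Proof.
move=> su; apply: (@fatou_sq _ _ _ mu (fun M => Gtrunc M d u)).
- by move=> M; exact: sq_integrable_mpoly.
- by move=> M; exact: sqn_Gtrunc_le.
- exact: measurable_Greal.
- by apply: aeW => t; exact: Gtrunc_cvg.
Qed.

(** By [moment_bessel] the squared moments are summable. The difference of two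
truncated operators is a polynomial whose coefficients are moments outside a
large box, so its norm is controlled by the tail of that sum. *)
Lemma Greal_cauchy u (e : R) : sqi u -> 0 < e ->
  exists N, forall m n, (N <= m)%N -> (N <= n)%N ->
    sqn mu (fun t => Greal m u t - Greal n u t) <= e.
Proof.
move=> su e0.
pose A := [set x | exists2 r, uniq r & x = \sum_(kappa <- r) moment u kappa ^+ 2].
have A0 : A !=set0 by exists 0, [::]; rewrite ?big_nil.
have Aub : ubound A (C * sqn mu u).
  by move=> _ [r ur ->]; exact: moment_bessel.
have hA : has_sup A by split=> //; exists (C * sqn mu u).
have C1 : 0 < C + 1 by rewrite ltr_wpDl.
have e1 : 0 < e / (C + 1) by rewrite divr_gt0.
have [_ [r ur ->] rA] := sup_adherent e1 hA.
have [N NP] := multiindices_bounded r.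
have key n m : (N <= n)%N -> (n <= m)%N ->
    sqn mu (fun t => Greal m u t - Greal n u t) <= e.
  move=> Nn nm.
  (* Truncating at (M + N).+1 instead of M ensures that the boxes contain all
  of r. *)
  have [] // := @fatou_sq _ _ _ mu
    (fun M t => Gtrunc (M + N).+1 m u t - Gtrunc (M + N).+1 n u t)
    (fun t => Greal m u t - Greal n u t) e.
  - by move=> M; apply: sq_integrableB; exact: sq_integrable_mpoly.
  - move=> M; set M' := (M + N).+1.
    pose D := [seq kappa <- box M' m | kappa \notin box M' n].
    have uD : uniq D by rewrite filter_uniq// box_uniq.
    rewrite (_ : (fun t => _) = mpoly D (moment u)); last first.
      by apply/funext => t; rewrite Gtrunc_sub.
    apply: le_trans (HC _ uD) _.
    have urD : uniq (r ++ D).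
      rewrite cat_uniq ur uD andbT; apply/hasPn => k.
      rewrite mem_filter => /andP[kn _]; apply: contra kn => /NP[k1 k2].
      apply: mem_box => j; first by move=> nj; rewrite k1// (leq_trans Nn).
      by rewrite (leq_trans (k2 j))// /M' ltnW// ltnS leq_addl.
    have : \sum_(k <- r ++ D) moment u k ^+ 2 <= sup A.
      by apply: sup_upper_bound => //; exists (r ++ D).
    rewrite big_cat/= => h.
    have : \sum_(k <- D) moment u k ^+ 2 <= e / (C + 1).
      by move: h rA; move: (\sum_(_ <- r) _) (\sum_(_ <- D) _) => *; lra.
    move=> /(ler_wpM2l C0)/le_trans; apply.
    by rewrite mulrCA ler_piMr ?(ltW e0)// ler_pdivrMr// mul1r lerDl.
  - by apply: measurable_funB; exact: measurable_Greal.
  - apply: aeW => t; have E d := @Gtrunc_cvg d u t su.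
    apply: cvgB.
      by have := E m; rewrite -(cvg_shiftn N.+1); under eq_fun do rewrite addnS.
    by have := E n; rewrite -(cvg_shiftn N.+1); under eq_fun do rewrite addnS.
exists N => m n Nm Nn; have [mn|/ltnW nm] := leqP m n; last exact: key.
by rewrite sqnBC; exact: key.
Qed.

Lemma Greal_limit u : sqi u -> exists2 g, sqi g &
  forall e : R, 0 < e -> exists N, forall n, (N <= n)%N ->
    sqn mu (fun t => Greal n u t - g t) <= e.
Proof.
move=> su; apply: sq_integrable_complete.
  by move=> n; have [] := Greal_bounded n su.
by move=> e e0; exact: Greal_cauchy.
Qed.

End Bounded.

(** Positivity of the kernel. For the truncated operators the integral on the
right is exactly the sum of the squared moments over a box, which contains [r]
once [M] is large. The passage to the limit is dominated by [2^d G_d|p| |p|],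
which is integrable because [G_d |p|] is square integrable. *)
Lemma moment_sq_le_Greal d r (p : borel_cube R -> R) : sqi p -> uniq r ->
  (forall kappa, kappa \in r -> forall j, (d <= j)%N -> kappa j = 0%N) ->
  sqi (Greal d (fun s => `|p s|)) ->
  \sum_(kappa <- r) moment p kappa ^+ 2 <= \int[mu]_t (Greal d p t * p t).
Proof.
move=> sp ur rd sG.
have [N NP] := multiindices_bounded r.
have cv : (\int[mu]_t (Gtrunc M d p t * p t)) @[M --> \oo] -->
    \int[mu]_t (Greal d p t * p t).
  have iG := integrableM_sq sG (sq_integrable_norm sp).
  apply: (@dominated_Rintegral_cvg _ _ _ mu (fun M t => Gtrunc M d p t * p t) _
    (fun t => 2 ^+ d * (Greal d (fun s => `|p s|) t * `|p t|))).
  - move=> M; apply: measurable_funM; last by case: sp.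
    by have [] := sq_integrable_mpoly (box M d) (moment p).
  - by move=> t; apply: cvgM; [exact: Gtrunc_cvg|exact: cvg_cst].
  - exact: (integrableZl measurableT (2 ^+ d) iG).
  - by move=> M t; rewrite normrM mulrA ler_wpM2r// Gtrunc_le.
rewrite -(cvg_lim _ cv)//; apply: limr_ge; first by apply/cvg_ex; eexists; exact: cv.
exists N => // M /= NM; rewrite Rintegral_mpolyM//.
rewrite [leRHS](bigID (fun k => k \in r))/=.
rewrite -[leLHS]addr0; apply: lerD; last first.
  by apply: sumr_ge0 => k _; rewrite -expr2 sqr_ge0.
rewrite -[leRHS]big_filter [leRHS](perm_big r) /=.
  by apply: ler_sum => k _; rewrite expr2.
apply: uniq_perm; rewrite ?filter_uniq ?box_uniq// => k.
rewrite mem_filter; case: (boolP (k \in r)) => //= kr.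
apply: mem_box => j; first exact: rd.
by have [_ k2] := NP k kr; rewrite (leq_trans (k2 j)).
Qed.

End RealOperators.

(** * The limit of the operators G_d *)

Section RealLimit.
Context (R : realType).
Variable mu : {finite_measure set (borel_cube R) -> \bar R}.
Implicit Types (u v g h : borel_cube R -> R) (t : borel_cube R).

Let sqi := sq_integrable mu.

Definition Glim u g := forall e : R, 0 < e -> exists N, forall n, (N <= n)%N ->
  sqn mu (fun t => Greal mu n u t - g t) <= e.

(** Write [P] for the squared norm of [p] and [A] for the sum of its squared
moments over [r]. Positivity gives [A <= <G_d p, p>] for all large [d]; as
[G_d p] tends to [h], this bounds [A^2] by [2 K P^2]. Since moreover [P] is
the inner product of the coefficients with the moments, a bound of [A] by [L
P] forces [P] to be at most [L] times the sum of the squared coefficients.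
Only the norm of the limit enters, so no uniform bound on the operators is
needed beforehand. *)
Lemma carleson_of_Glim (K : R) (r : seq multiindex) (c : multiindex -> R) h :
  let p := mpoly r c in
  uniq r -> 0 <= K -> (forall d, (0 < d)%N -> sqi (Greal mu d p)) ->
  (forall d, (0 < d)%N -> sqi (Greal mu d (fun s => `|p s|))) ->
  sqi h -> Glim p h -> sqn mu h <= K * sqn mu p ->
  sqn mu p <= (1 + 2 * K) * \sum_(kappa <- r) c kappa ^+ 2.
Proof.
move=> p ur K0 sG sGn sh ph hK.
have sp : sqi p by exact: sq_integrable_mpoly.
pose A := \sum_(kappa <- r) moment mu p kappa ^+ 2.
have A0 : 0 <= A by apply: sumr_ge0 => k _; exact: sqr_ge0.
have P0 := sqn_ge0 mu p.
have A2 : A ^+ 2 <= 2 * K * sqn mu p ^+ 2.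
  apply/ler_addgt0Pr => e e0.
  pose e' := e / (2 * sqn mu p + 1).
  have P1 : 0 < 2 * sqn mu p + 1 by rewrite ltr_wpDl// mulr_ge0.
  have e'0 : 0 < e' by rewrite divr_gt0.
  have [N NP] := ph e' e'0; have [d0 dP] := multiindices_bounded r.
  pose d := (maxn N d0).+1.
  have Ad : A <= \int[mu]_t (Greal mu d p t * p t).
    apply: moment_sq_le_Greal => //; last exact: sGn.
    move=> kappa /dP[k1 _] j dj; apply: k1; apply: leq_trans dj.
    by rewrite /d leqW// leq_maxr.
  have CS := cauchy_schwarz_sq (sG d isT) sp.
  have nG : sqn mu (Greal mu d p) <= 2 * (e' + K * sqn mu p).
    have := sqnD_le (sq_integrableB (sG d isT) sh) sh.
    under eq_fun do rewrite subrK.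
    move/le_trans; apply; rewrite ler_wpM2l// lerD//.
    by apply: NP; rewrite /d leqW// leq_maxl.
  apply: le_trans (_ : (\int[mu]_t (Greal mu d p t * p t)) ^+ 2 <= _).
    by rewrite lerXn2r ?nnegrE// (le_trans A0).
  apply: le_trans CS _; apply: le_trans (ler_wpM2r P0 nG) _.
  have E : e' * (2 * sqn mu p + 1) = e by rewrite /e' divfK// gt_eqF.
  have aux (P x : R) : 0 <= P -> 0 < x -> x * (2 * P + 1) = e ->
      2 * (x + K * P) * P <= 2 * K * P ^+ 2 + e by move=> *; nra.
  exact: aux.
(* 2 K <= (1 + 2 K)^2, which avoids a square root. *)
have AP : A <= (1 + 2 * K) * sqn mu p.
  rewrite -(@ler_pXn2r _ 2) ?nnegrE//; last by rewrite mulr_ge0// addr_ge0// mulr_ge0.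
  apply: le_trans A2 _; rewrite exprMn ler_wpM2r ?sqr_ge0//; nra.
have Ep : sqn mu p = \sum_(kappa <- r) c kappa * moment mu p kappa.
  by rewrite -Rintegral_mpolyM//; apply: eq_Rintegral => t _; rewrite expr2.
have L1 : 0 < 1 + 2 * K by rewrite ltr_wpDr// mulr_ge0.
(* With L = 1 + 2 K, expanding gives 0 <= S - 2 P / L + A / L^2 <= S - P / L,
where S is the sum of the squared coefficients. *)
have : 0 <= \sum_(kappa <- r) (c kappa - (1 + 2 * K)^-1 * moment mu p kappa) ^+ 2.
  by apply: sumr_ge0 => k _; exact: sqr_ge0.
rewrite (_ : \sum_(_ <- _) _ = \sum_(kappa <- r) c kappa ^+ 2
   - 2 * (1 + 2 * K)^-1 * sqn mu p + (1 + 2 * K)^-1 ^+ 2 * A); last first.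
  rewrite Ep !mulr_sumr -sumrN -!big_split/=.
  by apply: eq_bigr => k _; ring.
move: AP L1; move: (1 + 2 * K) (sqn mu p) (\sum_(_ <- _) _) => L P S AP L0 H.
rewrite -ler_pdivrMl// -subr_ge0; apply: le_trans H _.
rewrite -addrA lerD2l -subr_le0 opprK.
rewrite (_ : _ + _ = L^-1 * (L^-1 * A - P)); last by ring.
rewrite pmulr_rle0 ?invr_gt0// subr_le0.
by rewrite ler_pdivrMl.
Qed.

Section LimitOperator.
Variables (C : R) (C0 : 0 <= C) (HC : carleson_le mu C).

Lemma Glim_bounded u g : sqi u -> sqi g -> Glim u g ->
  sqn mu g <= 2 * C ^+ 2 * sqn mu u.
Proof.
move=> su sg ug; apply/ler_addgt0Pr => e e0.
have e2 : 0 < e / 2 by rewrite divr_gt0.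
have [N /(_ N (leqnn _)) NP] := ug _ e2.
have [sG Gle] := Greal_bounded C0 HC N su.
have := sqnD_le (sq_integrableB sg sG) sG.
under eq_fun do rewrite subrK.
rewrite sqnBC => /le_trans; apply.
by move: NP Gle; lra.
Qed.

(** Both sides are limits of the same sequence, by linearity of [Greal n]. *)
Lemma Glim_lin (a : R) u v g h k : sqi u -> sqi v -> sqi g -> sqi h -> sqi k ->
  Glim u g -> Glim v h -> Glim (fun t => a * u t + v t) k ->
  {ae mu, forall t, k t = a * g t + h t}.
Proof.
move=> su sv sg sh sk ug vh wk.
have sw : sqi (fun t => a * u t + v t).
  by apply: sq_integrableD => //; exact: sq_integrableZ.
have sagh : sqi (fun t => a * g t + h t).
  by apply: sq_integrableD => //; exact: sq_integrableZ.
have sD := sq_integrableB sk sagh.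
suff : sqn mu (fun t => k t - (a * g t + h t)) = 0.
  by move/(sqn_eq0_ae sD); apply: filterS => t /eqP; rewrite subr_eq0 => /eqP.
apply/eqP; rewrite eq_le sqn_ge0 andbT; apply/ler_addgt0Pr => e e0; rewrite add0r.
(* k - (a g + h) is the sum of k - G_n(a u + v) and a (G_n u - g) + (G_n v -
h); M is the constant that two uses of sqnD_le produce. *)
pose M := 2 * (1 + 2 * (a ^+ 2 + 1)).
have M0 : 0 < M by rewrite /M; have := sqr_ge0 a; lra.
have e1 : 0 < e / M by rewrite divr_gt0.
have [[N1 P1] [[N2 P2] [N3 P3]]] := conj (ug _ e1) (conj (vh _ e1) (wk _ e1)).
pose n := maxn N1 (maxn N2 N3).
have {}P1 : sqn mu (fun t => Greal mu n u t - g t) <= e / M.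
  by apply: P1; rewrite leq_maxl.
have {}P2 : sqn mu (fun t => Greal mu n v t - h t) <= e / M.
  by apply: P2; rewrite /n !leq_max leqnn orbT.
have {}P3 : sqn mu (fun t => k t - Greal mu n (fun t => a * u t + v t) t) <= e / M.
  by rewrite sqnBC; apply: P3; rewrite /n !leq_max leqnn !orbT.
have [su' _] := Greal_bounded C0 HC n su.
have [sv' _] := Greal_bounded C0 HC n sv.
have [sw' _] := Greal_bounded C0 HC n sw.
have d1 := sq_integrableB su' sg; have d2 := sq_integrableB sv' sh.
have d3 := sq_integrableB sk sw'; have d4 := sq_integrableZ a d1.
have := sqnD_le d3 (sq_integrableD d4 d2).
rewrite [X in sqn _ X <= _](_ : _ = fun t => k t - (a * g t + h t)); last first.
  by apply/funext => t; rewrite Greal_lin//; ring.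
move/le_trans; apply.
have D := sqnD_le d4 d2; rewrite sqnZ// in D.
have E : e = M * (e / M) by rewrite mulrCA divff ?mulr1// gt_eqF.
have a2 := ler_wpM2l (sqr_ge0 a) P1.
have aux (A W S U V x : R) : S <= 2 * (A * U + V) -> V <= x -> W <= x ->
    A * U <= A * x -> 2 * (W + S) <= 2 * (1 + 2 * (A + 1)) * x by move=> *; nra.
by rewrite [leRHS]E; exact: aux D P2 P3 a2.
Qed.

End LimitOperator.
End RealLimit.

(** * Complex polynomials and their real and imaginary parts *)

Section ComplexParts.
Context (R : realType).
Implicit Types z w : R[i].

Lemma sqr_normc_parts z : normc z ^+ 2 = complex.Re z ^+ 2 + complex.Im z ^+ 2.
Proof. by case: z => a b /=; rewrite sqr_sqrtr// addr_ge0// sqr_ge0. Qed.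

Lemma normc_le_parts z : normc z <= `|complex.Re z| + `|complex.Im z|.
Proof.
have n0 : 0 <= normc z by case: z => a b; exact: sqrtr_ge0.
rewrite -(@ler_pXn2r _ 2) ?nnegrE ?addr_ge0//.
rewrite sqr_normc_parts -[X in X + _]real_normK ?num_real//.
rewrite -[X in _ + X]real_normK ?num_real//.
have := normr_ge0 (complex.Re z); have := normr_ge0 (complex.Im z).
by move: `|complex.Re z| `|complex.Im z| => x y; nra.
Qed.

Lemma normc_real (x : R) : normc x%:C = `|x|.
Proof. by rewrite /= expr0n/= addr0 sqrtr_sqr. Qed.

Lemma Re_sum (I : Type) (r : seq I) (F : I -> R[i]) :
  complex.Re (\sum_(i <- r) F i) = \sum_(i <- r) complex.Re (F i).
Proof. by apply: (big_morph _ (id1 := 0)) => // -[a b] [a' b']. Qed.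

Lemma Im_sum (I : Type) (r : seq I) (F : I -> R[i]) :
  complex.Im (\sum_(i <- r) F i) = \sum_(i <- r) complex.Im (F i).
Proof. by apply: (big_morph _ (id1 := 0)) => // -[a b] [a' b']. Qed.

Lemma fs_sqnormE (K : choiceType) (f : {fsfun K -> R[i] with 0}) (r : seq K) :
  uniq r -> {subset finsupp f <= r} ->
  fs_sqnorm f = \sum_(k <- r) (complex.Re (f k) ^+ 2 + complex.Im (f k) ^+ 2).
Proof.
move=> ur fr; rewrite /fs_sqnorm.
rewrite (@big_finsupp_seq _ _ _ _ _ _ _ (fun _ z => normc z ^+ 2) r)//.
  by apply: eq_bigr => k _; rewrite sqr_normc_parts.
by move=> _; rewrite normc0 expr0n.
Qed.

Definition fsfun_real (K : choiceType) (r : seq K) (c : K -> R) :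
  {fsfun K -> R[i] with 0} := [fsfun k in seq_fset tt r => (c k)%:C].

Lemma fsfun_realE (K : choiceType) (r : seq K) (c : K -> R) k :
  k \in r -> fsfun_real r c k = (c k)%:C.
Proof. by move=> kr; rewrite fsfunE seq_fsetE kr. Qed.

Lemma fsfun_real_supp (K : choiceType) (r : seq K) (c : K -> R) :
  {subset finsupp (fsfun_real r c) <= r}.
Proof.
move=> k; rewrite mem_finsupp fsfunE seq_fsetE.
by case: ifP => //; rewrite eqxx.
Qed.

Lemma fs_sqnorm_real (K : choiceType) (r : seq K) (c : K -> R) : uniq r ->
  fs_sqnorm (fsfun_real r c) = \sum_(k <- r) c k ^+ 2.
Proof.
move=> ur; rewrite (fs_sqnormE ur (@fsfun_real_supp _ r c)).
rewrite !big_seq; apply: eq_bigr => k kr.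
by rewrite fsfun_realE//= expr0n addr0.
Qed.

End ComplexParts.

Section CarlesonReal.
Context (R : realType).
Variable mu : {finite_measure set (borel_cube R) -> \bar R}.

Lemma poly_eval_parts (f : {fsfun multiindex -> R[i] with 0}) (t : cube R) :
  poly_eval f t = mpoly (finsupp f) (fun k => complex.Re (f k)) t +i*
                  mpoly (finsupp f) (fun k => complex.Im (f k)) t.
Proof.
apply/eqP; rewrite eq_complex; apply/andP; split; apply/eqP.
  rewrite /poly_eval Re_sum; apply: eq_bigr => k _.
  by case: (f k) => a b /=; rewrite mulr0 subr0.
rewrite /poly_eval Im_sum; apply: eq_bigr => k _.
by case: (f k) => a b /=; rewrite mulr0 add0r.
Qed.

Lemma poly_eval_real r c (t : cube R) : uniq r ->
  poly_eval (fsfun_real r c) t = (mpoly r c t)%:C.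
Proof.
move=> ur; rewrite /poly_eval.
rewrite (@big_finsupp_seq _ _ _ _ _ _ _ (fun k z => z * (monomial t k)%:C) r)//.
- rewrite /mpoly rmorph_sum/= !big_seq; apply: eq_bigr => k kr.
  by rewrite fsfun_realE// rmorphM.
- by move=> k; rewrite mul0r.
- exact: fsfun_real_supp.
Qed.

(** At a point [t] with real coordinates, the squared modulus of a polynomial
is the sum of the squares of the two real polynomials formed from the real and
imaginary parts of its coefficients. *)
Lemma carleson_real : carleson mu <-> exists2 C : R, 0 <= C & carleson_le mu C.
Proof.
split=> [[C C0 HC]|[C C0 HC]].
  exists C => [|r c ur]; first exact: ltW.
  have := HC (fsfun_real r c); rewrite fs_sqnorm_real//.
  under eq_integral do rewrite poly_eval_real// normc_real real_normK ?num_real//.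
  by rewrite EFin_sqn ?lee_fin//; exact: sq_integrable_mpoly.
exists (C + 1) => [|f]; first by rewrite ltr_wpDl.
rewrite (fs_sqnormE (fset_uniq _) (fun _ => id)).
under eq_integral do rewrite poly_eval_parts sqr_normc_parts/= EFinD.
set p := mpoly _ _; set q := mpoly _ _.
have sp : sq_integrable mu p by exact: sq_integrable_mpoly.
have sq : sq_integrable mu q by exact: sq_integrable_mpoly.
rewrite integralD//; [|by case: sp|by case: sq].
rewrite !EFin_sqn// -EFinD lee_fin big_split/= mulrDr.
by apply: lerD; (apply: le_trans (HC _ _ (fset_uniq _)) _);
  rewrite ler_wpM2r ?lerDl// sumr_ge0// => k _; exact: sqr_ge0.
Qed.

End CarlesonReal.

(** * The Helson form as a Gram form *)

Section Helson.
Context (R : realType).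
Variable mu : {finite_measure set (borel_cube R) -> \bar R}.
Variable alpha : nat -> R[i].
Hypothesis halpha : forall kappa : multiindex,
  alpha (prime_monomial kappa) = (\int[mu]_t monomial t kappa)%:C.

Definition posnat_of_multiindex (kappa : multiindex) : posnat :=
  exist _ (prime_monomial kappa) (prime_monomial_gt0 kappa).

Definition multiindex_of_posnat (n : posnat) : multiindex :=
  prime_exponents (val n).

Lemma posnat_of_multiindexK : cancel posnat_of_multiindex multiindex_of_posnat.
Proof. by move=> kappa; exact: prime_monomialK. Qed.

Lemma multiindex_of_posnatK : cancel multiindex_of_posnat posnat_of_multiindex.
Proof. by case=> n n0; apply: val_inj => /=; exact: prime_exponentsK. Qed.

Lemma gram_mpoly (r q : seq multiindex) (c e : multiindex -> R) :
  \int[mu]_t (mpoly r c t * mpoly q e t) =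
  \sum_(kappa <- r) \sum_(lambda <- q)
    (\int[mu]_t monomial t (multiindex_add kappa lambda)) * c kappa * e lambda.
Proof.
rewrite Rintegral_mpolyM; last exact: sq_integrable_mpoly.
apply: eq_bigr => kappa _; rewrite moment_mpoly mulr_sumr.
by apply: eq_bigr => lambda _; ring.
Qed.

Lemma alphaM kappa lambda :
  alpha (prime_monomial kappa * prime_monomial lambda)%N =
  (\int[mu]_t monomial t (multiindex_add kappa lambda))%:C.
Proof. by rewrite -prime_monomialD halpha. Qed.

(** Since [alpha] at a product of two integers is an integral of a product of
monomials, the Helson form is a combination of inner products of real
polynomials. The lists [r] and [q] transport the supports from positive
integers to multi-indices. *)
Lemma helson_formE (f g : {fsfun posnat -> R[i] with 0})
    (r q : seq multiindex) : uniq r -> uniq q ->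
  {subset finsupp f <= map posnat_of_multiindex r} ->
  {subset finsupp g <= map posnat_of_multiindex q} ->
  let f1 k := complex.Re (f (posnat_of_multiindex k)) in
  let f2 k := complex.Im (f (posnat_of_multiindex k)) in
  let g1 k := complex.Re (g (posnat_of_multiindex k)) in
  let g2 k := complex.Im (g (posnat_of_multiindex k)) in
  helson_form alpha f g =
    (\int[mu]_t (mpoly r f1 t * mpoly q g1 t) +
     \int[mu]_t (mpoly r f2 t * mpoly q g2 t)) +i*
    (\int[mu]_t (mpoly r f2 t * mpoly q g1 t) -
     \int[mu]_t (mpoly r f1 t * mpoly q g2 t)).
Proof.
move=> ur uq fr gq f1 f2 g1 g2.
have inj : injective posnat_of_multiindex := can_inj posnat_of_multiindexK.
have E : helson_form alpha f g = \sum_(k <- r) \sum_(l <- q)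
    (\int[mu]_t monomial t (multiindex_add k l))%:C *
    f (posnat_of_multiindex k) * (g (posnat_of_multiindex l))^*.
  rewrite /helson_form.
  rewrite (@big_finsupp_seq _ _ _ f _ _ _
    (fun n z => \sum_(m <- finsupp g) alpha (val n * val m)%N * z * (g m)^*)
    (map posnat_of_multiindex r)) ?map_inj_uniq//; last first.
    by move=> n; apply: big1 => m _; rewrite mulr0 mul0r.
  rewrite big_map; apply: eq_bigr => k _.
  rewrite (@big_finsupp_seq _ _ _ g _ _ _ (fun m z =>
    alpha (val (posnat_of_multiindex k) * val m)%N *
    f (posnat_of_multiindex k) * z^*)
    (map posnat_of_multiindex q)) ?map_inj_uniq//; last first.
    by move=> m; rewrite rmorph0 mulr0.
  by rewrite big_map; apply: eq_bigr => l _; rewrite alphaM.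
apply/eqP; rewrite eq_complex E !gram_mpoly; apply/andP; split; apply/eqP => /=.
  rewrite Re_sum -big_split; apply: eq_bigr => k _.
  rewrite Re_sum -big_split; apply: eq_bigr => l _; rewrite /f1 /f2 /g1 /g2.
  by case: (f _) (g _) => a b [a' b'] /=; ring.
rewrite Im_sum -sumrB; apply: eq_bigr => k _.
rewrite Im_sum -sumrB; apply: eq_bigr => l _; rewrite /f1 /f2 /g1 /g2.
by case: (f _) (g _) => a b [a' b'] /=; ring.
Qed.

(** Each of the four real inner products is bounded by Cauchy-Schwarz and the
Carleson condition, whence the factor 4. *)
Lemma carleson_helson (C : R) : 0 <= C -> carleson_le mu C -> helson_bounded alpha.
Proof.
move=> C0 HC; exists (4 * C) => f g.
pose r := map multiindex_of_posnat (finsupp f).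
pose q := map multiindex_of_posnat (finsupp g).
have inj : injective multiindex_of_posnat := can_inj multiindex_of_posnatK.
have ur : uniq r by rewrite map_inj_uniq ?fset_uniq.
have uq : uniq q by rewrite map_inj_uniq ?fset_uniq.
have K (s : seq posnat) :
    map posnat_of_multiindex (map multiindex_of_posnat s) = s.
  by rewrite mapK//; exact: multiindex_of_posnatK.
have N (h : {fsfun posnat -> R[i] with 0}) (part : R[i] -> R) :
    (forall z, part z ^+ 2 <= complex.Re z ^+ 2 + complex.Im z ^+ 2) ->
    sqn mu (mpoly (map multiindex_of_posnat (finsupp h))
      (fun k => part (h (posnat_of_multiindex k)))) <= C * fs_sqnorm h.
  move=> hp; apply: le_trans (HC _ _ _) _; first by rewrite map_inj_uniq ?fset_uniq.
  rewrite ler_wpM2l// (fs_sqnormE (fset_uniq _) (fun _ => id)) big_map.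
  by apply: ler_sum => n _; rewrite multiindex_of_posnatK.
rewrite (@helson_formE f g r q)//; [|by rewrite K|by rewrite K].
have F0 (h : {fsfun posnat -> R[i] with 0}) : 0 <= fs_sqnorm h.
  by apply: sumr_ge0 => k _; exact: sqr_ge0.
have B (pf pg : R[i] -> R) :
    (forall z, pf z ^+ 2 <= complex.Re z ^+ 2 + complex.Im z ^+ 2) ->
    (forall z, pg z ^+ 2 <= complex.Re z ^+ 2 + complex.Im z ^+ 2) ->
    `|\int[mu]_t (mpoly r (fun k => pf (f (posnat_of_multiindex k))) t *
                  mpoly q (fun k => pg (g (posnat_of_multiindex k))) t)| <=
    C * Num.sqrt (fs_sqnorm f) * Num.sqrt (fs_sqnorm g).
  move=> hf hg; rewrite -(@ler_pXn2r _ 2) ?nnegrE//; last first.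
    by rewrite !mulr_ge0 ?sqrtr_ge0.
  rewrite real_normK ?num_real//.
  apply: le_trans (cauchy_schwarz_sq _ _) _; [exact: sq_integrable_mpoly..|].
  apply: le_trans (ler_pM (sqn_ge0 _ _) (sqn_ge0 _ _) (N f _ hf) (N g _ hg)) _.
  by rewrite !exprMn !sqr_sqrtr//; nra.
have hRe z : complex.Re z ^+ 2 <= complex.Re z ^+ 2 + complex.Im z ^+ 2 :> R.
  by rewrite lerDl sqr_ge0.
have hIm z : complex.Im z ^+ 2 <= complex.Re z ^+ 2 + complex.Im z ^+ 2 :> R.
  by rewrite lerDr sqr_ge0.
apply: le_trans (normc_le_parts _) _ => /=.
have := B _ _ hRe hRe; have := B _ _ hIm hIm.
have := B _ _ hIm hRe; have := B _ _ hRe hIm.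
move=> b1 b2 b3 b4.
apply: le_trans (lerD (ler_normD _ _) (ler_normB _ _)) _.
by rewrite -!mulrA [in leRHS]mulrA -!mulrA; move: b1 b2 b3 b4; rewrite -!mulrA; lra.
Qed.

(** On the diagonal the Helson form is the squared norm of the polynomial. *)
Lemma helson_carleson : helson_bounded alpha ->
  exists2 C : R, 0 <= C & carleson_le mu C.
Proof.
move=> [C HC]; exists `|C| => // r c ur.
have inj : injective posnat_of_multiindex := can_inj posnat_of_multiindexK.
pose r' := map posnat_of_multiindex r.
have ur' : uniq r' by rewrite map_inj_uniq.
pose f : {fsfun posnat -> R[i] with 0} :=
  fsfun_real r' (fun n => c (multiindex_of_posnat n)).
have := HC f f.
rewrite (@helson_formE f f r r)//; try exact: fsfun_real_supp.
have E1 t : mpoly r (fun k => complex.Re (f (posnat_of_multiindex k))) t = mpoly r c t.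
  rewrite /mpoly !big_seq; apply: eq_bigr => k kr.
  by rewrite /f fsfun_realE ?map_f// posnat_of_multiindexK.
have E2 t : mpoly r (fun k => complex.Im (f (posnat_of_multiindex k))) t = 0.
  rewrite /mpoly big_seq; apply: big1 => k kr.
  by rewrite /f fsfun_realE ?map_f//= mul0r.
under eq_Rintegral do rewrite !E1.
under [X in _ + X]eq_Rintegral do rewrite E2 mul0r.
under [X in X - _]eq_Rintegral do rewrite E2 mul0r.
under [X in _ - X]eq_Rintegral do rewrite E2 mulr0.
rewrite Rintegral_cst// mul0r subrr addr0 normc_real.
rewrite -mulrA -expr2 sqr_sqrtr; last first.
  by apply: sumr_ge0 => k _; exact: sqr_ge0.
rewrite fs_sqnorm_real// big_map.
under [X in _ <= _ * X -> _]eq_bigr do rewrite posnat_of_multiindexK.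
under eq_Rintegral do rewrite -expr2.
move=> H; apply: le_trans (ler_norm _) _; apply: le_trans H _.
by rewrite ler_wpM2r ?ler_norm// sumr_ge0// => k _; exact: sqr_ge0.
Qed.

Lemma helson_iff_carleson : helson_bounded alpha <-> carleson mu.
Proof.
rewrite carleson_real; split; first exact: helson_carleson.
by move=> [C C0 HC]; exact: carleson_helson HC.
Qed.

End Helson.

(** * From real to complex L^2 *)

Section ComplexL2.
Context d (T : measurableType d) (R : realType).
Variable mu : {finite_measure set T -> \bar R}.
Implicit Types f g : T -> R[i].

Definition part_re f x : R := complex.Re (f x).
Definition part_im f x : R := complex.Im (f x).

Definition sqnc f : R := sqn mu (part_re f) + sqn mu (part_im f).

Lemma sqnc_ge0 f : 0 <= sqnc f.
Proof. by rewrite addr_ge0// sqn_ge0. Qed.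

Lemma L2normE0 f : L2norm mu f = ((\int[mu]_x (normc (f x) ^+ 2)%:E) `^ 2^-1)%E.
Proof.
rewrite /L2norm unlock; congr (_ `^ _)%E; apply: eq_integral => x _.
rewrite abse_EFin poweR_EFin powR_mulrn//; congr EFin.
by rewrite ger0_norm//; case: (f x) => a b; exact: sqrtr_ge0.
Qed.

Lemma L2P f : L2 mu f <->
  sq_integrable mu (part_re f) /\ sq_integrable mu (part_im f).
Proof.
split=> [[mr mi fy]|[sr si]]; last first.
  split; [by case: sr|by case: si|].
  rewrite L2normE0; apply: poweR_lty.
  under eq_integral do rewrite sqr_normc_parts EFinD.
  rewrite integralD//; [|by case: sr|by case: si].
  by rewrite (EFin_sqn sr) (EFin_sqn si) -EFinD ltry.
have fy2 : (\int[mu]_x (normc (f x) ^+ 2)%:E < +oo)%E.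
  by apply: (@lty_poweRy _ _ 2^-1) => //; rewrite -L2normE0.
have mn : measurable_fun setT (fun x => (normc (f x) ^+ 2)%:E).
  under eq_fun do rewrite sqr_normc_parts EFinD.
  by apply: emeasurable_funD; apply/measurable_EFinP; exact: measurable_funX.
have I (w : T -> R) : measurable_fun setT w ->
    (forall x, w x ^+ 2 <= normc (f x) ^+ 2) -> sq_integrable mu w.
  move=> mw wf; split=> //.
  have mw2 : measurable_fun setT (fun x => (w x ^+ 2)%:E).
    by apply/measurable_EFinP; exact: measurable_funX.
  apply/integrableP; split=> //; apply: le_lt_trans fy2.
  under eq_integral do rewrite gee0_abs ?lee_fin ?sqr_ge0//.
  apply: ge0_le_integral => // x _; rewrite lee_fin ?sqr_ge0//.
split; apply: I => // x; rewrite sqr_normc_parts /part_re /part_im.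
  by rewrite lerDl sqr_ge0.
by rewrite lerDr sqr_ge0.
Qed.

Lemma L2normE f : L2 mu f -> L2norm mu f = (Num.sqrt (sqnc f))%:E.
Proof.
move=> /L2P[sr si]; rewrite L2normE0.
under eq_integral do rewrite sqr_normc_parts EFinD.
rewrite integralD//; [|by case: sr|by case: si].
rewrite (EFin_sqn sr) (EFin_sqn si) -EFinD poweR_EFin powR12_sqrt//.
exact: sqnc_ge0.
Qed.

Lemma L2B f g : L2 mu f -> L2 mu g -> L2 mu (fun x => f x - g x).
Proof.
move=> /L2P[fr fi] /L2P[gr gi]; apply/L2P; split.
  rewrite (_ : part_re _ = (fun x => part_re f x - part_re g x)).
    exact: sq_integrableB.
  by apply/funext => x; rewrite /part_re; case: (f x) (g x) => a b [].
rewrite (_ : part_im _ = (fun x => part_im f x - part_im g x)).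
  exact: sq_integrableB.
by apply/funext => x; rewrite /part_im; case: (f x) (g x) => a b [].
Qed.

Lemma sqncB f g : sqnc (fun x => f x - g x) =
  sqn mu (fun x => part_re f x - part_re g x) +
  sqn mu (fun x => part_im f x - part_im g x).
Proof.
rewrite /sqnc; congr +%R; congr sqn; apply/funext => x;
  by rewrite /part_re /part_im; case: (f x) (g x) => a b [].
Qed.

Lemma L2norm_leP (C : R) f g : 0 <= C -> L2 mu f -> L2 mu g ->
  sqnc g <= C ^+ 2 * sqnc f -> (L2norm mu g <= C%:E * L2norm mu f)%E.
Proof.
move=> C0 Lf Lg H; rewrite !L2normE// -EFinM lee_fin.
by rewrite -[C]ger0_norm// -sqrtr_sqr -sqrtrM ?sqr_ge0// ler_wsqrtr.
Qed.

Lemma sqnc_le (C : R) f g : L2 mu f -> L2 mu g ->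
  (L2norm mu g <= C%:E * L2norm mu f)%E -> sqnc g <= C ^+ 2 * sqnc f.
Proof.
move=> Lf Lg; rewrite !L2normE// -EFinM lee_fin => H.
rewrite -[leLHS](sqr_sqrtr (sqnc_ge0 _)) -[X in _ * X](sqr_sqrtr (sqnc_ge0 _)).
by rewrite -exprMn lerXn2r ?nnegrE ?sqrtr_ge0// (le_trans _ H)// sqrtr_ge0.
Qed.

(** The index 0 is left out because (3) speaks of the operators [Gop mu n] for
positive [n] only. *)
Lemma L2norm_cvg0P (h : nat -> T -> R[i]) : (forall n, (0 < n)%N -> L2 mu (h n)) ->
  ((fun n => L2norm mu (h n)) @ \oo --> 0%E) <->
  (forall e : R, 0 < e -> exists N, forall n, (N <= n)%N -> sqnc (h n) <= e).
Proof.
move=> Lh; split=> [/fine_cvgP[_ /cvgrPdist_le H] e e0|H].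
  have e1 : 0 < Num.sqrt e by rewrite sqrtr_gt0.
  have [N _ NP] := H _ e1; exists N.+1 => n Nn.
  have n0 : (0 < n)%N by exact: leq_ltn_trans Nn.
  have := NP n (ltnW Nn); rewrite /= L2normE//=; last exact: Lh.
  rewrite sub0r normrN ger0_norm ?sqrtr_ge0// ler_psqrt//.
    by rewrite nnegrE sqnc_ge0.
  by rewrite nnegrE ltW.
apply/fine_cvgP; split.
  by exists 1%N => // n /= n0; rewrite L2normE//; exact: Lh.
apply/cvgrPdist_le => e e0.
have [N NP] := H (e ^+ 2) (exprn_gt0 _ e0).
exists N.+1 => // n /= Nn; rewrite L2normE/=; last exact/Lh/(leq_ltn_trans _ Nn).
rewrite sub0r normrN ger0_norm ?sqrtr_ge0//.
by rewrite -[e]ger0_norm ?(ltW e0)// -sqrtr_sqr ler_wsqrtr// NP// ltnW.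
Qed.

End ComplexL2.

Section Equivalence.
Context (R : realType).
Variable mu : {finite_measure set (borel_cube R) -> \bar R}.
Implicit Types f g : borel_cube R -> R[i].

Lemma GopE n f t :
  Gop mu n f t = Greal mu n (part_re f) t +i* Greal mu n (part_im f) t.
Proof.
rewrite /Gop /cintegral; congr (_ +i* _); apply: eq_Rintegral => s _.
  by rewrite /part_re; case: (f s) => a b /=; rewrite mul0r subr0.
by rewrite /part_im; case: (f s) => a b /=; rewrite mul0r addr0.
Qed.

Lemma part_re_lin (a : R[i]) f g : part_re (fun y => a * f y + g y) =
  (fun y => complex.Re a * part_re f y +
    (- complex.Im a * part_im f y + part_re g y)).
Proof.
apply/funext => y; rewrite /part_re /part_im.
by case: a (f y) (g y) => a a' [b b'] [c c'] /=; ring.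
Qed.

Lemma part_im_lin (a : R[i]) f g : part_im (fun y => a * f y + g y) =
  (fun y => complex.Re a * part_im f y +
    (complex.Im a * part_re f y + part_im g y)).
Proof.
apply/funext => y; rewrite /part_re /part_im.
by case: a (f y) (g y) => a a' [b b'] [c c'] /=; ring.
Qed.

(** Real linearity, even if only almost everywhere, suffices: multiplication
by a complex scalar mixes the two parts through real coefficients. *)
Lemma complexify_bounded (H : (borel_cube R -> R) -> borel_cube R -> R) (K : R) :
  0 <= K ->
  (forall u, sq_integrable mu u -> sq_integrable mu (H u)) ->
  (forall a u v, sq_integrable mu u -> sq_integrable mu v ->
     {ae mu, forall t, H (fun s => a * u s + v s) t = a * H u t + H v t}) ->
  (forall u, sq_integrable mu u -> sqn mu (H u) <= K ^+ 2 * sqn mu u) ->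
  L2_bounded_operator mu (fun f t => H (part_re f) t +i* H (part_im f) t).
Proof.
move=> K0 sH linH bH.
have LH f : L2 mu f -> L2 mu (fun t => H (part_re f) t +i* H (part_im f) t).
  by move=> /L2P[fr fi]; apply/L2P; split; exact: sH.
split=> //.
- move=> a f g /L2P[fr fi] /L2P[gr gi].
  rewrite part_re_lin part_im_lin.
  have s1 : sq_integrable mu (fun s => - complex.Im a * part_im f s + part_re g s).
    by apply: sq_integrableD => //; exact: sq_integrableZ.
  have s2 : sq_integrable mu (fun s => complex.Im a * part_re f s + part_im g s).
    by apply: sq_integrableD => //; exact: sq_integrableZ.
  apply: filter_app (linH (complex.Re a) _ _ fr s1).
  apply: filter_app (linH (complex.Re a) _ _ fi s2).
  apply: filter_app (linH (- complex.Im a) _ _ fi gr).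
  apply: filterS (linH (complex.Im a) _ _ fr gi) => t e4 e3 e2 e1.
  rewrite e1 e2 e3 e4.
  by case: a {s1 s2 e1 e2 e3 e4} => a a' /=; congr (_ +i* _); ring.
- exists K => f Lf; apply: L2norm_leP => //; first exact: LH.
  by case/L2P: Lf => fr fi; rewrite /sqnc mulrDr lerD// bH.
Qed.

Section CarlesonG.
Variables (C : R) (C0 : 0 <= C) (HC : carleson_le mu C).

Lemma Gop_bounded n : L2_bounded_operator mu (Gop mu n).
Proof.
rewrite (_ : Gop mu n =
    fun f t => Greal mu n (part_re f) t +i* Greal mu n (part_im f) t).
  apply: (@complexify_bounded _ C) => //.
  - by move=> u su; have [] := Greal_bounded C0 HC n su.
  - by move=> a u v su sv; apply: aeW => t; exact: Greal_lin.
  - by move=> u su; have [] := Greal_bounded C0 HC n su.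
by apply/funext => f; apply/funext => t; exact: GopE.
Qed.

(** The limit is chosen function by function from the completeness of L^2; it
is linear almost everywhere by uniqueness of limits. *)
Lemma Gop_strong_limit : exists2 Ginf : (borel_cube R -> R[i]) -> borel_cube R -> R[i],
  L2_bounded_operator mu Ginf & L2_strong_cvg mu (Gop mu) Ginf.
Proof.
have /choice[H HP] : forall u, exists v : borel_cube R -> R,
    sq_integrable mu u ->
    sq_integrable mu v /\ Glim mu u v.
  move=> u; have [su|nu] := pselect (sq_integrable mu u).
    by have [g sg ug] := Greal_limit C0 HC su; exists g.
  by exists (cst 0) => /nu.
have bG : L2_bounded_operator mu (fun f t => H (part_re f) t +i* H (part_im f) t).
  apply: (@complexify_bounded H (2 * C)).
  - by rewrite mulr_ge0.
  - by move=> u /HP[].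
  - move=> a u v su sv; have [su' Gu] := HP u su; have [sv' Gv] := HP v sv.
    have suv : sq_integrable mu (fun s => a * u s + v s).
      by apply: sq_integrableD => //; exact: sq_integrableZ.
    have [suv' Guv] := HP _ suv.
    exact: (Glim_lin C0 HC su sv).
  - move=> u su; have [su' Gu] := HP u su.
    apply: le_trans (Glim_bounded C0 HC su su' Gu) _.
    rewrite ler_wpM2r ?sqn_ge0// exprMn ler_wpM2r ?sqr_ge0//.
    by rewrite expr2 -[leLHS]mulr1 ler_wpM2l// ler1n.
exists (fun f t => H (part_re f) t +i* H (part_im f) t) => // f Lf.
apply/L2norm_cvg0P.
  move=> n _; apply: L2B; first by have [+ _ _] := Gop_bounded n; apply.
  by case: bG => + _ _; apply.
move=> e e0; have /L2P[fr fi] := Lf.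
have e2 : 0 < e / 2 by rewrite divr_gt0.
have [_ Gr] := HP _ fr; have [_ Gi] := HP _ fi.
have [N1 P1] := Gr _ e2; have [N2 P2] := Gi _ e2.
exists (maxn N1 N2) => n; rewrite geq_max => /andP[/P1 h1 /P2 h2].
rewrite sqncB [leRHS]splitr; apply: lerD.
  by under eq_fun do rewrite /part_re GopE.
by under eq_fun do rewrite /part_im GopE.
Qed.

End CarlesonG.

(** Boundedness of [Gop] is applied to the modulus of a polynomial as well,
which provides the domination in [moment_sq_le_Greal]. *)
Lemma carleson_of_Gop (Ginf : (borel_cube R -> R[i]) -> borel_cube R -> R[i]) :
  (forall n, (0 < n)%N -> L2_bounded_operator mu (Gop mu n)) ->
  L2_bounded_operator mu Ginf -> L2_strong_cvg mu (Gop mu) Ginf ->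
  exists2 C : R, 0 <= C & carleson_le mu C.
Proof.
move=> bG [LG _ [K HK]] cG; exists (1 + 2 * K ^+ 2) => [|r c ur].
  by rewrite addr_ge0// mulr_ge0// sqr_ge0.
pose p := mpoly r c.
have sp : sq_integrable mu p by exact: sq_integrable_mpoly.
have s0 : sq_integrable mu (fun=> 0).
  by apply: (@sq_integrable_bounded _ _ _ _ _ 0) => // x; rewrite normr0.
have Lreal u : sq_integrable mu u -> L2 mu (fun t => (u t)%:C).
  by move=> su; apply/L2P.
have sG n u : (0 < n)%N -> sq_integrable mu u -> sq_integrable mu (Greal mu n u).
  move=> n0 su; have [+ _ _] := bG n n0.
  move=> /(_ _ (Lreal u su))/L2P[+ _]; rewrite (_ : part_re _ = Greal mu n u)//.
  by apply/funext => t; rewrite /part_re GopE.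
pose f t : R[i] := (p t)%:C.
have Lf : L2 mu f by exact: Lreal.
have /L2P[sh sh'] := LG f Lf.
apply: (@carleson_of_Glim _ mu (K ^+ 2) r c (part_re (Ginf f))) => //.
- exact: sqr_ge0.
- by move=> n n0; exact: sG.
- by move=> n n0; apply: sG => //; exact: sq_integrable_norm.
- have LB n : (0 < n)%N -> L2 mu (fun t => Gop mu n f t - Ginf f t).
    move=> n0; apply: L2B; last exact: LG.
    by have [+ _ _] := bG n n0; apply.
  move=> e e0; have [N NP] := (L2norm_cvg0P LB).1 (cG f Lf) e e0.
  exists N => n /NP; rewrite sqncB; apply: le_trans.
  under [X in _ <= sqn _ X + _]eq_fun do rewrite /part_re GopE.
  by rewrite lerDl sqn_ge0.
- have := sqnc_le Lf (LG f Lf) (HK f Lf).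
  rewrite /sqnc [sqn mu (part_im f)](_ : _ = 0) ?addr0; last first.
    rewrite /sqn; under eq_Rintegral do rewrite /part_im/= expr0n/=.
    by rewrite Rintegral_cst// mul0r.
  by apply: le_trans; rewrite lerDl sqn_ge0.
Qed.

Lemma carleson_iff_Gop : carleson mu <->
  ((forall n, (0 < n)%N -> L2_bounded_operator mu (Gop mu n)) /\
   exists2 Ginf : (borel_cube R -> R[i]) -> borel_cube R -> R[i],
     L2_bounded_operator mu Ginf & L2_strong_cvg mu (Gop mu) Ginf).
Proof.
rewrite carleson_real; split=> [[C C0 HC]|[bG [Ginf bI cG]]].
  split=> [n _|]; first exact: Gop_bounded HC _.
  exact: Gop_strong_limit HC.
exact: carleson_of_Gop bG bI cG.
Qed.

End Equivalence.

(** * The equivalence *)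

Theorem theorem4p7 (R : realType)
    (mu : {finite_measure set (borel_cube R) -> \bar R})
    (alpha : nat -> R[i])
    (halpha : forall kappa : multiindex,
      alpha (prime_monomial kappa) = (\int[mu]_t monomial t kappa)%:C) :
  (helson_bounded alpha <-> carleson mu) /\
  (carleson mu <->
    ((forall d : nat, (0 < d)%N -> L2_bounded_operator mu (Gop mu d)) /\
     exists2 Ginf : (borel_cube R -> R[i]) -> borel_cube R -> R[i],
       L2_bounded_operator mu Ginf & L2_strong_cvg mu (Gop mu) Ginf)).
Proof.
by split; [exact: helson_iff_carleson|exact: carleson_iff_Gop].
Qed.
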